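(* Let $\lambda$ be a plane partition of size $n$ and $|\tau\rangle_\lambda(z)$, $|\tau\rangle_\lambda(z,m)$ the vertex functions of $\mathrm{Hilb}^n(\mathbb C^3)$ at $\lambda$ with descendent, respectively tautological descendent, insertion $\tau$, as in the context. With the sums over all collections $(z_\square)_{\square\in\lambda}$ of the context, with $\mathcal V=\bigoplus_{\square\in\lambda}\mathcal L_\square$ the corresponding bundle, and writing $u_\square:=\hbar_\square+\langle\sigma,\square\rangle\hbar$, \begin{align*} |\tau\rangle_\lambda(z)&=\sum_{(z_\square)}z^{\sum_{\square}d_\square}\,\frac{e^{T_0}(\tau(\mathcal V)|_{\{0\}})\,e^{T_0}(\chi_{\mathbb P^1}(\mathcal End(\mathcal V)))}{e^{T_0}(\chi_{\mathbb P^1}(\mathcal V))\,e^{T_0}(\chi_{\mathbb P^1}(\bigoplus_{i=1}^3\mathcal End(\mathcal V)\otimes\mathcal L_i))}\\ &=\sum_{(z_\square)}z^{\sum_{\square}d_\square}\,\frac{e^{T_0}(\tau(\sum_{\square}\mathcal L_\square)|_{\{0\}})\,e^{T_0}(\chi_{\mathbb P^1}(\sum_{\square,\square'}\mathcal L_{\square'}^{-1}\otimes\mathcal L_\square))}{e^{T_0}(\chi_{\mathbb P^1}(\sum_{\square}\mathcal L_\square))\,e^{T_0}(\chi_{\mathbb P^1}(\bigoplus_{i=1}^3\sum_{\square,\square'}\mathcal L_{\square'}^{-1}\otimes\mathcal L_\square\otimes\mathcal L_i))}\\ &=\sum_{(z_\square)}\Big(\frac{z}{2\hbar}\Big)^{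\sum_{\square}d_\square}(2\hbar)^{-|\lambda|}\,\tau(\hbar_\square-\langle\sigma,\square\rangle\hbar+2d_\square\hbar)\prod_{\square\in\lambda}\frac{\Gamma_{2\hbar}(u_\square-2d_\square\hbar)}{\Gamma_{2\hbar}(u_\square+2\hbar)}\cdot\frac{\prod_{i=1}^3\prod_{\square,\square'\in\lambda}\frac{\Gamma_{2\hbar}(u_\square-u_{\square'}-2(d_\square-d_{\square'})\hbar+\hbar_i+\sigma_i\hbar)}{\Gamma_{2\hbar}(u_\square-u_{\square'}+\hbar_i-\sigma_i\hbar+2\hbar)}}{\prod_{\square,\square'\in\lambda}\frac{\Gamma_{2\hbar}(u_\square-u_{\square'}-2(d_\square-d_{\square'})\hbar)}{\Gamma_{2\hbar}(u_\square-u_{\square'}+2\hbar)}}, \end{align*} and similarly \begin{align*} |\tau\rangle_\lambda(z,m)&=\sum_{(z_\square)}z^{\sum_{\square}d_\square}\,\frac{e^{T_0\times\mathbb C^*}(\chi_{\mathbb P^1}(\mathcal V)\otimes e^m)\,e^{T_0}(\tau(\mathcal V)|_{\{0\}})\,e^{T_0}(\chi_{\mathbb P^1}(\mathcal End(\mathcal V)))}{e^{T_0}(\chi_{\mathbb P^1}(\mathcal V))\,e^{T_0}(\chi_{\mathbb P^1}(\bigoplus_{i=1}^3\mathcal End(\mathcal V)\otimes\mathcal L_i))}\\ &=\sum_{(z_\square)}z^{\sum_{\square}d_\square}\,\tau(\hbar_\square-\langle\sigma,\square\rangle\hbar+2d_\square\hbar)\cdot\frac{\prod_{\square\in\lamb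da}\frac{\Gamma_{2\hbar}(u_\square-2d_\square\hbar)}{\Gamma_{2\hbar}(u_\square+2\hbar)}}{\prod_{\square\in\lambda}\frac{\Gamma_{2\hbar}(u_\square-2d_\square\hbar+m)}{\Gamma_{2\hbar}(u_\square+2\hbar+m)}}\cdot\frac{\prod_{i=1}^3\prod_{\square,\square'\in\lambda}\frac{\Gamma_{2\hbar}(u_\square-u_{\square'}-2(d_\square-d_{\square'})\hbar+\hbar_i+\sigma_i\hbar)}{\Gamma_{2\hbar}(u_\square-u_{\square'}+\hbar_i-\sigma_i\hbar+2\hbar)}}{\prod_{\square,\square'\in\lambda}\frac{\Gamma_{2\hbar}(u_\square-u_{\square'}-2(d_\square-d_{\square'})\hbar)}{\Gamma_{2\hbar}(u_\square-u_{\square'}+2\hbar)}}. \end{align*}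
   Context: Target and torus. $\mathrm{Hilb}^n(\mathbb C^3)=\mathrm{Crit}(\phi)/\!\!/GL_n$ with $\phi=\mathrm{tr}(b_1[b_2,b_3])$ on $W=V\oplus\mathrm{End}(V)^{\oplus3}$, $V=\mathbb C^n$, cyclic stability ($\theta=\det$). $F=(\mathbb C^* )^3$ with weights $t_1,t_2,t_3$ scales $b_1,b_2,b_3$; $F_0=\{t_1t_2t_3=1\}$; $\hbar_i=c_1(t_i)$ (so $\hbar_1+\hbar_2+\hbar_3=0$ on $F_0$). $\mathbb C^*_q$ acts on $\mathbb P^1=\mathrm{Proj}\,\mathbb C[x,y]$ with $x$ of weight $-1$ and $y$ of weight $1$, $\infty=[1:0]$, $0=[0:1]$; $\hbar=-c_1(q)$; $T=F\times\mathbb C^*_q$, $T_0=F_0\times\mathbb C^*_q$. $H^0(\mathbb P^1,\mathcal O(1))$ has $\mathbb C^*_q$-eigenbasis $x,y$, so $\chi_{\mathbb P^1}(\mathcal O(d)q^d)=1+q^2+\cdots+q^{2d}$ for $d\ge0$, where $\chi_{\mathbb P^1}$ is equivariant Euler characteristic. Fix $\sigma_i\in\mathbb Z$, $\sigma_1+\sigma_2+\sigma_3=2$, $\mathcal L_i=\mathcal O(-\sigma_i)t_i$ ($R$-charge $t\mapsto(t^{-\sigma_1},t^{-\sigma_2},t^{-\sigma_3})$). Quasimaps. A twisted quasimap from $\mathbb P^1$ of degree $d$ is a rank $n$, degree $d$ bundle $\mathcal V$ with a section $u$ of $\mathcal V\oplus\bigoplus_i\mathcal End(\mathcal V)\otimes\mathcal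 L_i$ landing in the critical locus of $\phi$ (the three twisted endomorphisms commute) and generically stable. $QM_{d,\infty=\lambda}$ is the space of those that are stable at $\infty$ with value at $\infty$ the $F_0$-fixed point $\lambda$ (a plane partition of size $n$, with boxes $\square=(i_1,i_2,i_3)\in\mathbb N^3$). Its $T$-fixed points are isolated, labelled by $(z_\square)_{\square\in\lambda}$ with $z_\square\in\mathbb N$, $z_{i_1,i_2,i_3}\geqslant z_{i_1-1,i_2,i_3},z_{i_1,i_2-1,i_3},z_{i_1,i_2,i_3-1}$ (when these boxes exist) and $\sum_\square d_\square=d$, where $\mathcal V=\bigoplus_\square\mathcal L_\square$, $\mathcal L_{(i_1,i_2,i_3)}=\mathcal L_1^{-i_1}\mathcal L_2^{-i_2}\mathcal L_3^{-i_3}\mathcal O(z_\square)q^{z_\square}$. Notation: $\langle\sigma,\square\rangle=\sum_ji_j\sigma_j$, $d_\square=z_\square+\langle\sigma,\square\rangle$, $\hbar_\square=-\sum_ji_j\hbar_j$. Vertex functions. For $\tau\in K_{GL_n\times T}(\mathrm{pt})$, $\tau(\mathcal V)$ is the associated class (Schur functors of $\mathcal V$ with weights), $\tau(\mathcal V)|_{\{0\}}$ its restriction to $0\in\mathbb P^1$. In the Gamma-function expressions, $\tau(x_\square)$ denotes the insertion evaluated at the values $(x_\square)_{\square\in\lambda}$ of the Chern roots. The vertex functions are defined by torus localization: $$|\tau\rangle_\lambda(z)=\sum_dz^d\sum_{(\mathcal V,u)\in (QM_{d,\infty=\lambda})^T}\frac{e^{T_0}(\tau(\mathcal V)|_{\{0\}})}{\sqrt{(-1)^{\mathrm{vdim}/2}e^{T_0}(\mathbb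 T^{vir}_{(\mathcal V,u)})}},$$ where $\mathbb T^{vir}$ is the virtual tangent complex of the moduli space of quasimaps smooth at $\infty$, i.e. the restricted tangent complex of its derived enhancement (derived mapping stack into the derived critical locus), whose relative part over the stack of $GL_n$-bundles is, in K-theory, $\mathbf R\Gamma(\mathcal W)+\mathbf R\Gamma(\mathcal W)^\vee$ with $\mathcal W=\mathcal V\oplus\bigoplus_i\mathcal End(\mathcal V)\otimes\mathcal L_i$; $\mathrm{vdim}$ is its rank, and the sign of the square root is chosen so that it equals $e^{T_0}(\mathbf R\Gamma(\mathcal W))\,e^{T_0}(-\mathbf R\Gamma(\mathcal End\,\mathcal V))$. $|\tau\rangle_\lambda(z,m)$ is the same with the extra factor $e^{T_0\times\mathbb C^*}(\chi_{\mathbb P^1}(\mathcal V)\otimes e^m)$ in the numerator, $e^m$ a trivial line bundle with $c_1^{\mathbb C^*}(e^m)=m$. Conventions. $\Gamma_{2\hbar}(x):=\Gamma(x/2\hbar)$. Where a factor is at a pole, $\Gamma_{2\hbar}(-2d\hbar)$ ($d\in\mathbb N$) is read as $\frac{(-1)^d}{d!}\Gamma_{2\hbar}(0)$ with $\Gamma_{2\hbar}(0)$ a formal symbol $1/e^{T_0}(1)$; likewise zero weights in Euler classes are kept as formal factors $e^{T_0}(1)$. All these formal factors cancel between numerator and denominator in each summand.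
   Formalization: In both Gamma formulas the argument of τ is corrected to ħ_□+⟨σ,□⟩ħ−2d_□ħ (= u_□−2d_□ħ), the Chern root at 0 when ħ=−c₁(q); the printed sign fails for n=1, τ=V, d=1 (true value −2ħ, printed +2ħ). *)

(* Defs.v *)
From HB Require Import structures.
From mathcomp Require Import all_boot all_order all_algebra perm finmap.
From mathcomp Require Import all_classical all_reals all_analysis.
From mathcomp Require Import complex freeg.

Set Implicit Arguments.
Unset Strict Implicit.
Unset Printing Implicit Defensive.

Import Order.TTheory GRing.Theory Num.Theory.
Import numFieldNormedType.Exports.

Local Open Scope classical_set_scope.
Local Open Scope ring_scope.

(* The character t_1^a1 t_2^a2 t_3^a3 q^b of T = (C^* )^3 x C^*_q is (a, b);
   characters are written additively. *)
Notation Tchar := ({ffun 'I_3 -> int} * int)%type.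

Definition tchar (k : 'I_3) : Tchar := ([ffun l => (l == k)%:R], 0).
Definition qchar : Tchar := (0, 1).

Notation KT := {freeg Tchar / int}.

(* Pic_T(P^1), written additively: (d, chi) is O(d) twisted by chi, where O(d)
   has the linearization for which the sections x, y of O(1) have C^*_q-weights
   -1 and 1. *)
Notation PicT := (int * Tchar)%type.

Definition OP1 (d : int) : PicT := (d, 0).
Definition triv (chi : Tchar) : PicT := (0, chi).
Definition degL (L : PicT) : int := L.1.

Notation KTP1 := {freeg PicT / int}.

Definition fgmap (X Y : choiceType) (f : X -> Y) (D : {freeg X / int}) :
    {freeg Y / int} :=
  fglift (fun x => << f x >> : {freeg Y / int}) D.

Definition dualK (D : KT) : KT := fgmap (fun chi : Tchar => - chi) D.

(* A split T-equivariant vector bundle on P^1 is the list of its summands. *)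
Definition bundle : Type := seq PicT.
Definition lineK (L : PicT) : KTP1 := << L >>.
Definition class (E : bundle) : KTP1 := \sum_(L <- E) lineK L.
Definition dualB (E : bundle) : bundle := [seq - L | L <- E].
Definition tensorB (E E' : bundle) : bundle := [seq L + L' | L <- E, L' <- E'].
Definition EndB (E : bundle) : bundle := tensorB (dualB E) E.
Definition degB (E : bundle) : int := \sum_(L <- E) degL L.

(* Equivariant Euler characteristic, from the Cech complex of {x <> 0, y <> 0}:
   for d >= 0, H^0(O(d)) has basis x^(d-b) y^b with 0 <= b <= d;
   for d = -(n+1), H^1(O(d)) has basis x^-(n-b) y^-(b+1) with 0 <= b < n. *)
Definition chi_line (L : PicT) : KT :=
  match L.1 with
  | Posz d => \sum_(0 <= b < d.+1) << L.2 + qchar *~ (b%:Z - (d - b)%N%:Z) >>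
  | Negz n => - \sum_(0 <= b < n) << L.2 + qchar *~ ((n - b)%N%:Z - b.+1%:Z) >>
  end.

Definition chiP1 (D : KTP1) : KT := fglift chi_line D.

(* Restriction to 0 = [0:1]: there y trivializes O(1), so O(1)|_0 = q. *)
Definition at0_line (L : PicT) : Tchar := L.2 + qchar *~ L.1.
Definition at0 (D : KTP1) : KT := fgmap at0_line D.

Notation box := {ffun 'I_3 -> nat}.

Record plane_partition (n : nat) := PlanePartition {
  boxes :> {fset box};
  boxes_closed : forall b c : box,
    (forall k, (c k <= b k)%N) -> b \in boxes -> c \in boxes;
  boxes_size : #|` boxes| = n }.

(* The boxes of a plane partition of size n, enumerated by 'I_n. *)
Definition boxn n (lam : plane_partition n) (i : 'I_n) : box :=
  nth [ffun=> 0%N] (boxes lam) i.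

Definition sbox n (lam : plane_partition n) (sigma : 'I_3 -> int) (i : 'I_n) : int :=
  \sum_(k < 3) (boxn lam i k)%:Z * sigma k.

Definition dbox n (lam : plane_partition n) (sigma : 'I_3 -> int)
    (z : {ffun 'I_n -> nat}) (i : 'I_n) : int :=
  (z i)%:Z + sbox lam sigma i.

Definition Ltw (sigma : 'I_3 -> int) (k : 'I_3) : PicT :=
  OP1 (- sigma k) + triv (tchar k).

Definition Lbox n (lam : plane_partition n) (sigma : 'I_3 -> int)
    (z : {ffun 'I_n -> nat}) (i : 'I_n) : PicT :=
  \sum_(k < 3) (- (Ltw sigma k *+ boxn lam i k))
  + OP1 (z i)%:Z + triv (qchar *~ (z i)%:Z).

Definition calV n (lam : plane_partition n) (sigma : 'I_3 -> int)
    (z : {ffun 'I_n -> nat}) : bundle :=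
  [seq Lbox lam sigma z i | i <- enum 'I_n].

Definition EndL (sigma : 'I_3 -> int) (E : bundle) : bundle :=
  flatten [seq tensorB (EndB E) [:: Ltw sigma k] | k <- enum 'I_3].

Definition calW (sigma : 'I_3 -> int) (E : bundle) : bundle := E ++ EndL sigma E.

Definition admissible n (lam : plane_partition n) (z : {ffun 'I_n -> nat}) : Prop :=
  forall (i j : 'I_n) (k : 'I_3),
    (forall l, boxn lam i l = (boxn lam j l + (l == k))%N) -> (z j <= z i)%N.

(* (QM_{d, oo = lam})^T, through its labelling by the collections z. *)
Definition QMfixed n (lam : plane_partition n) (sigma : 'I_3 -> int) (d : int) :
    set {ffun 'I_n -> nat} :=
  [set z | admissible lam z /\ degB (calV lam sigma z) = d].

(* K-theory class of the virtual tangent complex at (V, u): the relative part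
   over Bun_GL(n), then the tangent complex - RGamma(End V) of Bun_GL(n) and its
   dual, which comes from the derived critical locus. *)
Definition Tvir (sigma : 'I_3 -> int) (E : bundle) : KT :=
  let RW := chiP1 (class (calW sigma E)) in
  let RE := chiP1 (class (EndB E)) in
  (RW + dualK RW) - (RE + dualK RE).

(* ((a_i), chi) is the character prod_i x_i^(a_i) chi of the maximal torus of
   GL_n x T. *)
Notation GLTchar n := ({ffun 'I_n -> int} * Tchar)%type.

(* K_{GL_n x T}(pt), as the S_n-invariants of the representation ring of the
   maximal torus. *)
Record KGLT (n : nat) := MkKGLT {
  KGLT_val :> {freeg (GLTchar n) / int};
  KGLT_sym : forall (s : 'S_n) (w : GLTchar n),
    coeff (([ffun i => w.1 (s i)], w.2) : GLTchar n) KGLT_val = coeff w KGLT_val }.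

Definition tauB n (tau : KGLT n) (V : 'I_n -> PicT) : KTP1 :=
  fgmap (fun w : GLTchar n => \sum_(i < n) V i *~ w.1 i + triv w.2) tau.

(* Elements of the localized ring are represented by their values at a point
   (hb, hbar) of Lie(T_0); [e1] is the value given to the formal symbol
   e^{T_0}(1). *)
Record eqparam (R : realType) := EqParam {
  hb : 'I_3 -> R[i];
  hbar : R[i];
  e1 : R[i] }.

Definition c1q (R : realType) (P : eqparam R) : R[i] := - hbar P.

Definition c1 (R : realType) (P : eqparam R) (chi : Tchar) : R[i] :=
  \sum_(k < 3) hb P k *~ chi.1 k + c1q P *~ chi.2.

Definition T0trivial (chi : Tchar) : Prop :=
  (forall k l, chi.1 k = chi.1 l) /\ chi.2 = 0.

(* A very general point of Lie(T_0): only the characters that are trivial on T_0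
   have zero first Chern class. *)
Definition generic (R : realType) (P : eqparam R) : Prop :=
  [/\ \sum_(k < 3) hb P k = 0, e1 P != 0 &
      forall chi, c1 P chi = 0 -> T0trivial chi].

(* The same for T_0 x C^*, with m = c_1(e^m). *)
Definition generic_mass (R : realType) (P : eqparam R) (m : R[i]) : Prop :=
  forall (k : int) chi, m *~ k + c1 P chi = 0 -> k = 0.

(* A Chern class, with the zero class read as the formal symbol. *)
Definition efac (R : realType) (P : eqparam R) (x : R[i]) : R[i] :=
  if x == 0 then e1 P else x.

Definition euler_gen (R : realType) (P : eqparam R) (X : choiceType)
    (c : X -> R[i]) (D : {freeg X / int}) : R[i] :=
  \prod_(x <- dom D) efac P (c x) ^ coeff x D.

Definition euler (R : realType) (P : eqparam R) (D : KT) : R[i] :=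
  euler_gen P (c1 P) D.

(* Classes in K_{T x C^*}(pt): (chi, k) is the character chi e^(k m). *)
Notation KTm := {freeg (Tchar * int) / int}.

Definition twist_em (D : KT) : KTm := fgmap (fun chi : Tchar => (chi, 1 : int)) D.

Definition euler_m (R : realType) (P : eqparam R) (m : R[i]) (D : KTm) : R[i] :=
  euler_gen P (fun w : Tchar * int => c1 P w.1 + m *~ w.2) D.

Definition tau_at (R : realType) (P : eqparam R) n (tau : KGLT n)
    (x : 'I_n -> R[i]) : R[i] :=
  euler_gen P (fun w : GLTchar n => \sum_(i < n) x i *~ w.1 i + c1 P w.2) tau.

(* The square root of [x] whose sign is chosen so that it equals [ref]. *)
Definition sqrt_sign (R : realType) (ref x : R[i]) : R[i] :=
  if sqrtC x == ref then sqrtC x else - sqrtC x.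

Definition sqrt_euler (R : realType) (P : eqparam R) (sigma : 'I_3 -> int)
    (E : bundle) : R[i] :=
  let T := Tvir sigma E in
  let vdim := freeg.deg T in
  sqrt_sign
    (euler P (chiP1 (class (calW sigma E))) * euler P (- chiP1 (class (EndB E))))
    ((-1) ^ (vdim %/ 2)%Z * euler P T).

(* Laurent series in z are given by their coefficients. *)
Definition vertex (R : realType) (P : eqparam R) n (lam : plane_partition n)
    (sigma : 'I_3 -> int) (tau : KGLT n) (d : int) : R[i] :=
  \sum_(z \in QMfixed lam sigma d)
    euler P (at0 (tauB tau (Lbox lam sigma z)))
    / sqrt_euler P sigma (calV lam sigma z).

Definition vertex_m (R : realType) (P : eqparam R) (m : R[i]) n
    (lam : plane_partition n) (sigma : 'I_3 -> int) (tau : KGLT n) (d : int) : R[i] :=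
  \sum_(z \in QMfixed lam sigma d)
    (euler_m P m (twist_em (chiP1 (class (calV lam sigma z))))
     * euler P (at0 (tauB tau (Lbox lam sigma z))))
    / sqrt_euler P sigma (calV lam sigma z).

(* Coefficients of sum_z F(z) z^(sum_i d_i), over all admissible collections. *)
Definition zseries (R : realType) n (lam : plane_partition n) (sigma : 'I_3 -> int)
    (F : {ffun 'I_n -> nat} -> R[i]) (d : int) : R[i] :=
  \sum_(z \in [set z | admissible lam z /\ \sum_(i < n) dbox lam sigma z i = d]) F z.

Definition natcpow (R : realType) (n : nat) (w : R[i]) : R[i] :=
  let r := expR (complex.Re w * ln n%:R) in
  let t := complex.Im w * ln n%:R in
  ((r * cos t) +i* (r * sin t))%C.

(* Euler's limit n! n^w / (w (w+1) ... (w+n)), for w not in {0, -1, ...}. *)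
Definition cGamma (R : realType) (w : R[i]) : R[i] :=
  limn ((fun n : nat => n`!%:R * natcpow n w / \prod_(0 <= j < n.+1) (w + j%:R))
        : nat -> (R[i])^o).

(* Gamma_{2 hbar}(x), where at a pole x = -2 d hbar it is (-1)^d / d! times the
   formal symbol Gamma_{2 hbar}(0) = 1 / e^{T_0}(1). *)
Definition Gamma2h (R : realType) (P : eqparam R) (x : R[i]) : R[i] :=
  match pselect (exists d : nat, x = - (2 * d%:R * hbar P)) with
  | left pole => let d := projT1 (cid pole) in (-1) ^+ d / d`!%:R * (e1 P)^-1
  | right _ => cGamma (x / (2 * hbar P))
  end.

Definition hbox (R : realType) (P : eqparam R) n (lam : plane_partition n)
    (i : 'I_n) : R[i] :=
  - \sum_(k < 3) hb P k *+ boxn lam i k.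

Definition ubox (R : realType) (P : eqparam R) n (lam : plane_partition n)
    (sigma : 'I_3 -> int) (i : 'I_n) : R[i] :=
  hbox P lam i + (sbox lam sigma i)%:~R * hbar P.

(* Chern root of V at 0 in P^1 on the summand of the i-th box. It involves hbar
   through c_1(q), so its hbar-part is - sbox * c_1(q) + 2 d * c_1(q). *)
Definition xbox (R : realType) (P : eqparam R) n (lam : plane_partition n)
    (sigma : 'I_3 -> int) (z : {ffun 'I_n -> nat}) (i : 'I_n) : R[i] :=
  hbox P lam i - (sbox lam sigma i)%:~R * c1q P
  + 2 * (dbox lam sigma z i)%:~R * c1q P.

Lemma degL_Lbox n (lam : plane_partition n) sigma z (i : 'I_n) :
  degL (Lbox lam sigma z i) = dbox lam sigma z i.
Proof.
rewrite /degL /Lbox /dbox /sbox.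
have fstD (L M : PicT) : (L + M).1 = L.1 + M.1 by [].
rewrite !fstD /= addr0 addrC; congr (_ + _).
rewrite (big_morph (fun L : PicT => L.1) fstD (erefl : (0 : PicT).1 = 0)).
apply: eq_bigr => k _.
have fstMn (L : PicT) m : (L *+ m).1 = L.1 *+ m.
  by elim: m => [//|m IH]; rewrite !mulrS fstD IH.
have -> : (- (Ltw sigma k *+ boxn lam i k)).1 = - (Ltw sigma k *+ boxn lam i k).1 by [].
by rewrite fstMn /Ltw fstD /= addr0 mulNrn opprK mulrC -mulr_natr natz.
Qed.

Lemma degB_calV n (lam : plane_partition n) sigma z :
  degB (calV lam sigma z) = \sum_(i < n) dbox lam sigma z i.
Proof.
rewrite /degB /calV big_map big_enum /=.
by apply: eq_bigr => i _; exact: degL_Lbox.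
Qed.

Lemma QMfixed_finite n (lam : plane_partition n) sigma d :
  finite_set (QMfixed lam sigma d).
Proof.
pose N := absz (d - (\sum_(i < n) sbox lam sigma i))%R.
apply: (@sub_finite_set _ _ [set [ffun i => val (f i)] | f in [set: {ffun 'I_n -> 'I_N.+1}]]).
  move=> z [_]; rewrite degB_calV big_split /= => dE.
  have sE : \sum_(i < n) (z i)%:Z = d - \sum_(i < n) sbox lam sigma i.
    by rewrite -dE addrK.
  have zN i : (z i < N.+1)%N.
    rewrite ltnS /N -sE -lez_nat.
    have -> : (absz (\sum_(i < n) (z i)%:Z)%R : int) = \sum_(i < n) (z i)%:Z.
      by rewrite gez0_abs // sumr_ge0.
    by rewrite (bigD1 i) //= lerDl sumr_ge0.
  exists [ffun i => Ordinal (zN i)] => //.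
  by apply/ffunP => i; rewrite !ffunE.
apply: finite_image; exact: finite_finset.
Qed.

(* Main.v *)
(* The K-theoretic quotient is a product over line bundles [M] of Euler classes
   of [chi(M)], whose weights are an arithmetic progression of step [2 hbar];
   the functional equation of the Gamma function turns each such product into a
   quotient of two Gamma values.  Zero weights contribute a sign under duality
   and, because of the normalization of [Gamma_{2 hbar}(0)], a factor [2 hbar].
   Their signed number in [chi(V) + chi(End V (x) L) - chi(End V)] vanishes:
   only differences of boxes on the diagonal [(c,c,c)] contribute, with sign
   [1] if [c >= 0] and [-1] otherwise by monotonicity of [z], and the resulting
   count is shown to be [0] by removing the boxes of the plane partition one by
   one. *)

Require Import Defs.
From mathcomp Require Import all_boot all_order all_algebra finmap.
From mathcomp Require Import all_classical all_reals all_analysis.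
From mathcomp Require Import complex freeg ring lra zify.

Set Implicit Arguments.
Unset Strict Implicit.
Unset Printing Implicit Defensive.

Import Order.TTheory GRing.Theory Num.Theory.
Import numFieldNormedType.Exports.
Local Open Scope ring_scope.

(** * Counting diagonal differences of boxes *)

(** One telescoping principle serves twice. If [f x * g x = a * g (x + 2 * h)], the product of [f]
    over the weights of [chi_line L] depends only on the two ends of the progression. With [Gamma2h]
    as [g] this gives the Gamma quotients; with the inverse indicator weight of the poles as [g] it
    counts zero weights, because [x] is a pole exactly when [x = 0] or [x + 2 * h] is a pole. The
    count is needed with weight [-1] for the square root and with weight [2 * h] for the Gamma form,
    hence for an arbitrary nonzero weight. Classes are evaluated at a point of Lie(T_0), so Gamma is
    a complex number given by a [limn]. Its functional equation and the divisions require that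
    Euler's limit exists and is nonzero; both come from ratios of consecutive terms of size 1 +
    O(1/n^2). The condition that the sum of the [sigma k] is 2 acts in two places: on diagonal
    characters it makes the degree shift even, so that the progression can hit zero, and it makes
    the powers of [2 * h] from End V and from its three twists agree. Only the power coming from V
    survives. *)

(* The signed number of [T_0]-trivial weights in the Euler characteristic of a
   line bundle whose [t]-weight is [-v]. *)
Definition diagsgn (v : 'I_3 -> int) : int :=
  if (v ord0 == v (inord 1)) && (v ord0 == v (inord 2)) then
    if 0 <= v ord0 then 1 else -1 else 0.

Lemma ord3P (P : 'I_3 -> Prop) : P ord0 -> P (inord 1) -> P (inord 2) -> forall k, P k.
Proof.
move=> p0 p1 p2 [[|[|[|//]]] h].
- by have -> : Ordinal h = ord0 by apply: val_inj.
- by have -> : Ordinal h = inord 1 by apply: val_inj; rewrite /= inordK.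
- by have -> : Ordinal h = inord 2 by apply: val_inj; rewrite /= inordK.
Qed.

Lemma big_ord3 (V : nmodType) (F : 'I_3 -> V) :
  \sum_(k < 3) F k = F ord0 + F (inord 1) + F (inord 2).
Proof.
rewrite !big_ord_recl big_ord0 addr0 addrA.
by congr (_ + F _ + F _); apply: val_inj; rewrite /= ?inordK.
Qed.

Lemma inord3_eq : ((inord 1 == ord0 :> 'I_3) = false) * ((inord 2 == ord0 :> 'I_3) = false)
  * ((ord0 == inord 1 :> 'I_3) = false) * ((ord0 == inord 2 :> 'I_3) = false)
  * ((inord 1 == inord 2 :> 'I_3) = false) * ((inord 2 == inord 1 :> 'I_3) = false).
Proof. by do !split; rewrite -val_eqE /= ?inordK. Qed.

Lemma sum_indicator (T : eqType) (s S : seq T) (F : T -> int) (c : int) :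
  uniq s -> uniq S -> {subset S <= s} ->
  (forall x, x \in s -> F x = if x \in S then c else 0) ->
  \sum_(x <- s) F x = c *+ size S.
Proof.
move=> us uS Ss FE.
transitivity (\sum_(x <- s | x \in S) c).
  by rewrite [RHS]big_mkcond; apply: eq_big_seq.
rewrite big_const_seq iter_addr_0; congr (c *+ _).
rewrite -size_filter; apply: perm_size; apply: uniq_perm => //.
  exact: filter_uniq.
by move=> x; rewrite mem_filter andb_idr // => /Ss.
Qed.

Definition zvec (b : box) : 'I_3 -> int := fun k => (b k)%:Z.
Definition unitv (k : 'I_3) : 'I_3 -> int := fun l => (l == k)%:R.

Definition down_closed (A : seq box) : Prop :=
  forall b c : box, (forall k, (c k <= b k)%N) -> b \in A -> c \in A.

Section Corner.
Variables (A : seq box) (w : box).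
Hypothesis Auniq : uniq A.
Hypothesis Aclosed : forall b c : box,
  (forall k, (c k <= b k)%N) -> b \in w :: A -> c \in w :: A.
Hypothesis wmax : forall b : box, (forall k, (w k <= b k)%N) -> b \in w :: A -> b = w.
Hypothesis wA : w \notin A.

Let below (v : 'I_3 -> int) (m : nat) : seq box :=
  [seq [ffun l => `|v l - t%:Z|%N] | t <- iota 0 m].

Lemma below_uniq v m : (forall k, m%:Z <= v k + 1) -> uniq (below v m).
Proof.
move=> vm; rewrite map_inj_in_uniq ?iota_uniq // => s t.
rewrite !mem_iota /= => hs ht /ffunP /(_ ord0); rewrite !ffunE.
by have := vm ord0; lia.
Qed.

(* The boxes [j] of [A] on the diagonal below [v] are the [v - t (1,1,1)] with
   [0 <= t < m], where [m] is the minimum of the coordinates of [v], plus one. *)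
Lemma sum_diag_below (v : 'I_3 -> int) (m : nat) (F : box -> int) (c : int) :
  (forall k, m%:Z <= v k + 1) -> (exists k, m%:Z = v k + 1) ->
  (forall k, v k <= (w k)%:Z) -> (exists k, v k < (w k)%:Z) ->
  (forall j, j \in A -> (exists t : nat, forall k, v k - (j k)%:Z = t%:Z) -> F j = c) ->
  (forall j, j \in A -> ~ (exists t : nat, forall k, v k - (j k)%:Z = t%:Z) -> F j = 0) ->
  \sum_(j <- A) F j = c *+ m.
Proof.
move=> vm [k1 mE] vw [k0 vk0] F1 F0.
rewrite (@sum_indicator _ A (below v m) F c) ?size_map ?size_iota //.
- exact: below_uniq.
- move=> x /mapP[t]; rewrite mem_iota /= => tm ->.
  set x' := [ffun _ => _].
  have x'E k : (x' k)%:Z = v k - t%:Z by rewrite ffunE; have := vm k; lia.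
  have : x' \in w :: A.
    apply: (Aclosed (b := w)); last exact: mem_head.
    by move=> k; rewrite -lez_nat x'E; have := vw k; lia.
  (* Strictness of [v] below [w] at [k0] rules out [x' = w]. *)
  rewrite in_cons => /orP[/eqP /(congr1 (fun f : box => (f k0)%:Z))|//].
  by rewrite x'E; lia.
- move=> j jA; case: ifPn => [/mapP[t]|jn].
    rewrite mem_iota /= => tm jE; apply: F1 => //; exists t => k.
    rewrite jE ffunE; have := vm k; lia.
  apply: F0 => // -[t tE]; move/negP: jn; apply; apply/mapP; exists t.
    by rewrite mem_iota /=; have := tE k1; lia.
  by apply/ffunP => k; rewrite ffunE; have := tE k; lia.
Qed.

Lemma diagsgnP v : 
  (exists c, (forall k, v k = c) /\ diagsgn v = (if 0 <= c then 1 else -1)) \/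
  ((forall c, ~ (forall k, v k = c)) /\ diagsgn v = 0).
Proof.
rewrite /diagsgn; case: ifPn => [/andP[/eqP v1 /eqP v2]|vn].
  by left; exists (v ord0); split=> //; apply: ord3P.
by right; split=> // c vc; move: vn; rewrite !vc eqxx.
Qed.

Lemma diagsgn_const v c : (forall k, v k = c) -> diagsgn v = (if 0 <= c then 1 else -1).
Proof. by move=> vc; rewrite /diagsgn !vc eqxx. Qed.

Lemma diagsgn_nconst v : (forall c, ~ (forall k, v k = c)) -> diagsgn v = 0.
Proof.
by move=> vn; case: (diagsgnP v) => [[c [/vn]]|[]].
Qed.

(** A negative constant difference would place [j] above the maximal box [w], so every diagonal term
    has sign 1. They are the boxes below [w - e_k] on its diagonal; [m] may be 0, when [w - e_k]
    leaves the octant. *)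
Lemma sum_diagsgn_lower k (m : nat) :
  (forall l, m%:Z <= (w l)%:Z - unitv k l + 1) ->
  (exists l, m%:Z = (w l)%:Z - unitv k l + 1) ->
  \sum_(j <- A) diagsgn (fun l => (w l)%:Z - (j l)%:Z - unitv k l) = m.
Proof.
move=> m1 m2; rewrite (@sum_diag_below (fun l => (w l)%:Z - unitv k l) m _ 1) //.
- by rewrite natz.
- by move=> l; rewrite /unitv; lia.
- by exists k; rewrite /unitv eqxx; lia.
- move=> j jA [t tE]; rewrite (diagsgn_const (c := t)) //.
  by move=> l; rewrite -(tE l) /=; ring.
- move=> j jA nt; apply: diagsgn_nconst => c cE.
  have [c0|c0] := leP 0 c.
    by apply: nt; exists `|c|%N => l /=; have := cE l; lia.
  have : j = w.
    apply: wmax; last by rewrite in_cons jA orbT.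
    by move=> l; have := cE l; rewrite /unitv; case: (_ == _); lia.
  by move=> jw; move: wA; rewrite -jw jA.
Qed.

(** A nonnegative constant difference would again place [j] above [w]. The sign -1 starts at the
    constant -1, so the topmost candidate is [w + e_k - (1,1,1)], which explains the shift by
    one. *)
Lemma sum_diagsgn_upper k (m : nat) :
  (forall l, m%:Z <= (w l)%:Z + unitv k l) ->
  (exists l, m%:Z = (w l)%:Z + unitv k l) ->
  \sum_(j <- A) diagsgn (fun l => (j l)%:Z - (w l)%:Z - unitv k l) = - m%:Z.
Proof.
move=> m1 m2; rewrite (@sum_diag_below (fun l => (w l)%:Z + unitv k l - 1) m _ (-1)) //.
- by rewrite mulNrn natz.
- by move=> l; have := m1 l; lia.
- by have [l lE] := m2; exists l; lia.
- by move=> l; rewrite /unitv; case: (_ == _); lia.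
(* Strict inequality below [w] holds at any coordinate other than [k]. *)
- have [->|k0] := eqVneq k ord0.
    by exists (inord 1); rewrite /unitv inord3_eq; lia.
  by exists ord0; rewrite /unitv eq_sym (negPf k0); lia.
- move=> j jA [t tE]; rewrite (diagsgn_const (c := - (t%:Z + 1))).
    by case: ifPn; lia.
  by move=> l; have /= := tE l; lia.
- move=> j jA nt; apply: diagsgn_nconst => c cE.
  have [c0|c0] := ltP c 0.
    by apply: nt; exists `|- c - 1|%N => l /=; have := cE l; lia.
  have : j = w.
    apply: wmax; last by rewrite in_cons jA orbT.
    by move=> l; have := cE l; rewrite /unitv; case: (_ == _); lia.
  by move=> jw; move: wA; rewrite -jw jA.
Qed.

Let mn (a b c : nat) : nat := minn a (minn b c).

(** For [w = (a,b,c)] the claim becomes an identity between minima: the terms min(a,b+1,c+1) -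
    min(a+1,b,c), summed over the three choices of the distinguished coordinate, give 0 if a = b = c
    and 1 otherwise. The first term of the statement supplies the missing 1 on the diagonal. *)
Lemma diagsgn_corner :
  diagsgn (fun l => (w l)%:Z) - 1 +
  \sum_(k < 3) (\sum_(j <- A) diagsgn (fun l => (w l)%:Z - (j l)%:Z - unitv k l)
    + \sum_(j <- A) diagsgn (fun l => (j l)%:Z - (w l)%:Z - unitv k l)) = 0.
Proof.
set a := w ord0; set b := w (inord 1); set c := w (inord 2).
have lo k m := @sum_diagsgn_lower k m.
have up k m := @sum_diagsgn_upper k m.
rewrite big_ord3.
have pick3 (x y z : nat) (f : 'I_3 -> int) m : f ord0 = x%:Z -> f (inord 1) = y%:Z ->
   f (inord 2) = z%:Z -> m = mn x y z -> 
   (forall l, m%:Z <= f l) /\ (exists l, m%:Z = f l).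
  move=> f0 f1 f2 ->; split; first by apply: ord3P; rewrite ?f0 ?f1 ?f2 /mn; lia.
  have : mn x y z = x \/ mn x y z = y \/ mn x y z = z by rewrite /mn; lia.
  by case=> [->|[->|->]]; [exists ord0|exists (inord 1)|exists (inord 2)].
have L k x y z : (w ord0)%:Z - unitv k ord0 + 1 = x%:Z ->
    (w (inord 1))%:Z - unitv k (inord 1) + 1 = y%:Z ->
    (w (inord 2))%:Z - unitv k (inord 2) + 1 = z%:Z ->
    \sum_(j <- A) diagsgn (fun l => (w l)%:Z - (j l)%:Z - unitv k l) = mn x y z.
  move=> h0 h1 h2.
  by have [] := pick3 x y z (fun l => (w l)%:Z - unitv k l + 1) _ h0 h1 h2 erefl; exact: lo.
have U k x y z : (w ord0)%:Z + unitv k ord0 = x%:Z ->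
    (w (inord 1))%:Z + unitv k (inord 1) = y%:Z ->
    (w (inord 2))%:Z + unitv k (inord 2) = z%:Z ->
    \sum_(j <- A) diagsgn (fun l => (j l)%:Z - (w l)%:Z - unitv k l) = - (mn x y z)%:Z.
  move=> h0 h1 h2.
  by have [] := pick3 x y z (fun l => (w l)%:Z + unitv k l) _ h0 h1 h2 erefl; exact: up.
rewrite (L ord0 a b.+1 c.+1) ?(U ord0 a.+1 b c) ?(L (inord 1) a.+1 b c.+1)
  ?(U (inord 1) a b.+1 c) ?(L (inord 2) a.+1 b.+1 c) ?(U (inord 2) a b c.+1);
  rewrite ?/unitv ?inord3_eq ?eqxx -/a -/b -/c; try lia.
rewrite /diagsgn -/a -/b -/c /mn !eqz_nat; case: ifPn; lia.
Qed.
End Corner.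

Lemma diagsgn_opp v : (exists k, v k != 0) -> diagsgn v + diagsgn (fun k => - v k) = 0.
Proof.
move=> [k vk]; rewrite /diagsgn !eqr_opp.
case: ifPn => // /andP[/eqP v1 /eqP v2].
have : v ord0 != 0.
  by apply: contra vk => /eqP v0; move: v1 v2; rewrite v0 => v1 v2; apply/eqP; move: k; apply: ord3P.
by rewrite oppr_ge0; case: ltgtP.
Qed.

(** Adding a corner [w] to [A'] changes the untwisted double sum only by the pair [(w, w)], which
    contributes 1: the pairs [(w, j)] and [(j, w)] have opposite signs and cancel. In the twisted
    sums [(w, w)] contributes nothing, since [e_k] is not diagonal. The remaining change is the
    corner identity. *)
Lemma diagsgn_total (A : seq box) :
  uniq A -> down_closed A ->
  \sum_(b <- A) diagsgn (zvec b)
  + \sum_(k < 3) \sum_(b <- A) \sum_(c <- A)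
      diagsgn (fun l => zvec b l - zvec c l - unitv k l)
  - \sum_(b <- A) \sum_(c <- A) diagsgn (fun l => zvec b l - zvec c l) = 0.
Proof.
have [m] := ubnP (size A); elim: m A => // m IH A sA uA cA.
have [->|A0] := eqVneq A [::].
  by rewrite !big_nil big1 // => k _; rewrite big_nil.
(* A box of maximal coordinate sum is maximal for the componentwise order, so the set stays closed
   after its removal. *)
pose ht (b : box) := (\sum_(k < 3) b k)%N.
have [w wA wmax] : exists2 w : box, w \in A & forall b : box, b \in A -> (ht b <= ht w)%N.
  have : exists n, has (fun b => ht b == n) A.
    by case: A A0 {sA uA cA} => // b A _; exists (ht b); rewrite /= eqxx.
  move=> ex; have ub n : has (fun b => ht b == n) A -> (n <= \max_(b <- A) ht b)%N.
    by case/hasP => b bA /eqP <-; exact: leq_bigmax_seq.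
  case: (ex_maxnP ex ub) => n /hasP[w wA /eqP wn] nmax.
  by exists w => // b bA; rewrite wn; apply: nmax; apply/hasP; exists b.
pose A' := rem w A.
have pA : perm_eq A (w :: A') := perm_to_rem wA.
have uA' : uniq A' := rem_uniq _ uA.
have wA' : w \notin A' by rewrite mem_rem_uniqF.
have memA b : (b \in w :: A') = (b \in A) by rewrite (perm_mem pA).
have wtop (b : box) : (forall k, (w k <= b k)%N) -> b \in A -> b = w.
  have ht3 x : ht x = (x ord0 + x (inord 1) + x (inord 2))%N by exact: big_ord3.
  move=> wb /wmax; rewrite !ht3 => h.
  have E k : b k = w k.
    have := wb ord0; have := wb (inord 1); have := wb (inord 2).
    by move: k; apply: ord3P; lia.
  exact/ffunP.
have cA' : down_closed A'.
  move=> b c cb bA'; have bA : b \in A by rewrite -memA in_cons bA' orbT.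
  have := cA b c cb bA; rewrite -memA in_cons => /orP[/eqP cw|//].
  have bw : b = w by apply: wtop => // k; rewrite -cw.
  by move: wA'; rewrite -bw bA'.
have clos (b c : box) : (forall k, (c k <= b k)%N) -> b \in w :: A' -> c \in w :: A'.
  by rewrite !memA; exact: cA.
have wtop' (b : box) : (forall k, (w k <= b k)%N) -> b \in w :: A' -> b = w.
  by rewrite memA; exact: wtop.
have corner := diagsgn_corner uA' clos wtop' wA'.
have sA' : (size A' < m)%N by move: sA; rewrite (perm_size pA).
have {}IH := IH _ sA' uA' cA'.
have ins (F : box -> box -> int) : 
    \sum_(b <- A) \sum_(c <- A) F b c =
    F w w + (\sum_(j <- A') F w j + \sum_(j <- A') F j w)
    + \sum_(b <- A') \sum_(c <- A') F b c.
  have E : \sum_(b <- A') \sum_(c <- A) F b c = \sum_(b <- A') (F b w + \sum_(c <- A') F b c).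
    by apply: eq_bigr => b _; rewrite (perm_big _ pA) big_cons.
  by rewrite (perm_big _ pA) big_cons E (perm_big _ pA) big_cons big_split /= !addrA.
rewrite (perm_big _ pA) big_cons.
rewrite (eq_bigr (fun k => (\sum_(j <- A') diagsgn (fun l => zvec w l - zvec j l - unitv k l)
    + \sum_(j <- A') diagsgn (fun l => zvec j l - zvec w l - unitv k l))
    + \sum_(b <- A') \sum_(c <- A') diagsgn (fun l => zvec b l - zvec c l - unitv k l)));
  last first.
  move=> k _; rewrite ins.
  rewrite (diagsgn_nconst (v := fun l => zvec w l - zvec w l - unitv k l)) ?add0r //.
  move=> c cE; have /= := cE k; rewrite /unitv eqxx => e1.
  have [k0|k0] := eqVneq k ord0.
    by have /= := cE (inord 1); rewrite k0 /unitv inord3_eq; move: e1; lia.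
  by have /= := cE ord0; rewrite /unitv eq_sym (negPf k0); move: e1; lia.
rewrite big_split /= ins.
rewrite (@diagsgn_const (fun l => zvec w l - zvec w l) 0) ?lexx; last by move=> k; rewrite subrr.
have -> : \sum_(j <- A') diagsgn (fun l => zvec w l - zvec j l)
    + \sum_(j <- A') diagsgn (fun l => zvec j l - zvec w l) = 0.
  rewrite -big_split big_seq big1 //= => j jA'.
  have [k kP] : exists k, zvec w k - zvec j k != 0.
    apply/existsP; apply: contraNT wA'; rewrite negb_exists => /forallP h.
    suff -> : w = j by [].
    apply/ffunP => k; have := h k; rewrite negbK subr_eq0 /zvec.
    by rewrite eqz_nat => /eqP.
  rewrite -[RHS](@diagsgn_opp (fun l => zvec w l - zvec j l)); last by exists k.
  by congr (_ + diagsgn _); apply/funext => l; rewrite opprB.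
move: corner IH; rewrite /zvec.
move=> c1 c2; rewrite -[RHS](addr0 0) -[X in _ = X + _]c1 -[X in _ = _ + X]c2; ring.
Qed.

(** [admissible] compares adjacent boxes only. Closedness of the plane partition provides a chain of
    adjacent boxes from [i] to [j], found by lowering one excess coordinate of [j] at a time. *)
Lemma box_monotone n (lam : plane_partition n) (z : {ffun 'I_n -> nat}) (i j : 'I_n) :
  admissible lam z -> (forall k, (boxn lam i k <= boxn lam j k)%N) -> (z i <= z j)%N.
Proof.
move=> adm.
have sz : size (boxes lam) = n by rewrite -[RHS](boxes_size lam).
have mem_boxn (l : 'I_n) : boxn lam l \in boxes lam by rewrite mem_nth ?sz.
have [m] := ubnP (\sum_(k < 3) (boxn lam j k - boxn lam i k))%N; elim: m j => // m IH j.
rewrite ltnS => jm ij.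
have [/forallP jle|] := boolP [forall k, (boxn lam j k <= boxn lam i k)%N].
  have : boxn lam i = boxn lam j.
    by apply/ffunP => k; apply/eqP; rewrite eqn_leq ij jle.
  move/eqP; rewrite nth_uniq ?sz ?fset_uniq //.
  by move=> /eqP /val_inj ->.
rewrite negb_forall => /existsP[k]; rewrite -ltnNge => ijk.
(* Since coordinate [k] of [j] exceeds that of [i], it is positive and the truncated subtraction is
   a genuine one. *)
pose b : box := [ffun l => (boxn lam j l - (l == k))%N].
have bmem : b \in boxes lam.
  by apply: (boxes_closed (b := boxn lam j)) => // l; rewrite ffunE leq_subr.
have bi : (index b (boxes lam) < n)%N by move: bmem; rewrite -index_mem sz.
pose i' := Ordinal bi.
have i'E : boxn lam i' = b by rewrite /boxn /= nth_index.
have jE l : boxn lam j l = (boxn lam i' l + (l == k))%N.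
  by rewrite i'E ffunE; case: eqVneq => [->|_] /=; lia.
apply: (@leq_trans (z i')); last exact: adm jE.
apply: IH.
  apply: leq_trans jm; rewrite [X in (_ < X)%N](bigD1 k) //= (bigD1 k) //= i'E ffunE eqxx.
  have -> : (\sum_(l < 3 | l != k) (b l - boxn lam i l)
      = \sum_(l < 3 | l != k) (boxn lam j l - boxn lam i l))%N.
    by apply: eq_bigr => l lk; rewrite ffunE (negPf lk) subn0.
  by rewrite ltn_add2r; move: ijk; lia.
by move=> l; have := jE l; have := ij l; case: eqVneq => [->|_] /=; lia.
Qed.

(** * Euler's limit for the complex Gamma function *)

Section ComplexSequences.
Variable R : realType.
Implicit Types (u : nat -> R[i]) (x y : R[i]).

Local Notation N := (@Normc.normc R).

(** The norm of [R[i]] takes values in [R[i]]; this passes to the real-valued modulus, on which the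
    estimates are carried out. *)
Lemma normc_normE x : `|x| = (N x)%:C%C. Proof. by case: x. Qed.

Lemma normc_ge0 x : 0 <= N x.
Proof. by rewrite -lecR -normc_normE normr_ge0. Qed.

Lemma normc_gt0 x : (0 < N x) = (x != 0).
Proof. by rewrite -ltcR -normc_normE normr_gt0. Qed.

Lemma normc_triangle x y : N (x + y) <= N x + N y.
Proof. exact: le_normcD. Qed.

Lemma normc_dist x y : N (x - y) = N (y - x).
Proof. by rewrite -[in LHS](opprB y x); exact: normcN. Qed.

Lemma normc_real (a : R) : N (a%:C)%C = `|a|.
Proof. by rewrite /= expr0n /= addr0 sqrtr_sqr. Qed.

Lemma normc_nat (n : nat) : N n%:R = n%:R.
Proof.
by apply: complexI; rewrite -normc_normE normr_nat rmorph_nat.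
Qed.

Lemma normc_le_ReIm x : N x <= `|complex.Re x| + `|complex.Im x|.
Proof.
case: x => a b /=; rewrite -[leRHS]ger0_norm; last by rewrite addr_ge0.
rewrite -sqrtr_sqr ler_wsqrtr //.
rewrite sqrrD !real_normK ?num_real //.
have ab := mulr_ge0 (normr_ge0 a) (normr_ge0 b).
rewrite [leRHS]addrAC lerDl mulrn_wge0 //.
Qed.

Lemma Re_le_normc x : `|complex.Re x| <= N x.
Proof. by case: x => a b /=; rewrite -sqrtr_sqr ler_wsqrtr // lerDl sqr_ge0. Qed.

Lemma Im_le_normc x : `|complex.Im x| <= N x.
Proof. by case: x => a b /=; rewrite -sqrtr_sqr ler_wsqrtr // lerDr sqr_ge0. Qed.

Lemma cvgc_of_dist u (l : R[i]) (K : R) (M : nat) :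
  (forall n, (M <= n)%N -> (0 < n)%N -> N (l - u n) <= K / n%:R) ->
  ((u : nat -> (R[i])^o) n @[n --> \oo] --> (l : (R[i])^o))%classic.
Proof.
move=> ul; apply/(@cvgrPdist_le R[i] (R[i])^o) => eps eps0.
have epsE : eps = (complex.Re eps)%:C%C by rewrite RRe_real // gtr0_real.
have e0 : 0 < complex.Re eps by rewrite -ltcR -epsE.
near=> n.
have n0 : (0 < n)%N by near: n; exact: nbhs_infty_gt.
rewrite epsE (normc_normE (l - u n)) lecR; apply: (le_trans (ul _ _ n0)).
  by near: n; exact: nbhs_infty_ge.
rewrite ler_pdivrMr ?ltr0n // [complex.Re eps * _]mulrC -ler_pdivrMr //.
near: n.
exists (Num.truncn (K / complex.Re eps)).+1 => // k /=.
rewrite -(ler_nat R) => kK; apply: le_trans kK.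
exact/ltW/truncnS_gt.
Unshelve. all: by end_near.
Qed.

(** Real and imaginary part are 1-Lipschitz, so completeness of [R] applies to each; adding the two
    errors produces the factor 2. *)
Lemma cauchy_dist_lim u (K : R) (M : nat) :
  (forall n m, (M <= n)%N -> (0 < n <= m)%N -> N (u m - u n) <= K / n%:R) ->
  exists l : R[i], forall n, (M <= n)%N -> (0 < n)%N -> N (l - u n) <= 2 * K / n%:R.
Proof.
move=> uK.
have lim_real (p : R[i] -> R) : (forall x y, `|p x - p y| <= N (x - y)) ->
  exists l : R, forall n, (M <= n)%N -> (0 < n)%N -> `|l - p (u n)| <= K / n%:R.
  move=> pN.
  have cv : cvgn (fun n => p (u n)).
    apply/cauchy_cvgP; apply: cauchy_exP => eps eps0.
    pose k := maxn M (Num.truncn (2 * K / eps)).+1.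
    have k0 : (0 < k)%N by rewrite leq_max orbT.
    have Kk : 2 * K / k%:R < eps.
      rewrite ltr_pdivrMr ?ltr0n // [eps * _]mulrC -ltr_pdivrMr //.
      apply: lt_le_trans (truncnS_gt _) _; rewrite ler_nat; exact: leq_maxr.
    exists (p (u k)); exists k => // i /= ki; rewrite /ball /= distrC.
    apply: le_lt_trans Kk; apply: le_trans (pN _ _) _.
    have := uK k i (leq_maxl _ _); rewrite k0 ki => /(_ isT) h.
    apply: le_trans h _; rewrite ler_pM2r ?invr_gt0 ?ltr0n //.
    have := le_trans (normc_ge0 _) (uK k k (leq_maxl _ _) _); rewrite k0 leqnn => /(_ isT).
    by rewrite pmulr_lge0 ?invr_gt0 ?ltr0n //; lra.
  exists (limn (fun n => p (u n))) => n Mn n0.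
  rewrite distrC.
  have cv' : ((fun m => `|p (u n) - p (u m)|) m @[m --> \oo]
      --> `|p (u n) - limn (fun n => p (u n))|)%classic.
    apply: cvg_norm; apply: cvgB cv; exact: cvg_cst.
  rewrite -(cvg_lim (@Rhausdorff R) cv').
  apply: limr_le; first by apply/cvg_ex; eexists; exact: cv'.
  exists n => // m /= nm; rewrite distrC; apply: le_trans (pN _ _) _; apply: uK => //.
  by rewrite n0.
have [a aP] := lim_real (@complex.Re R) (fun x y => ltac:(
  by case: x => ? ?; case: y => ? ?; exact: (Re_le_normc (_ +i* _)%C))).
have [b bP] := lim_real (@complex.Im R) (fun x y => ltac:(
  by case: x => ? ?; case: y => ? ?; exact: (Im_le_normc (_ +i* _)%C))).
exists (a +i* b)%C => n Mn n0.
apply: le_trans (normc_le_ReIm _) _.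
have := aP n Mn n0; have := bP n Mn n0.
case: (u n) => c d /=; rewrite -mulrA; lra.
Qed.

(* The product of the ratios [u n.+1 / u n = 1 + O(1/n^2)] converges to a nonzero
   limit; the error is telescoped through [1/n^2 <= 2 (1/n - 1/(n+1))]. *)
Lemma ratio_quadratic_cvg u (C : R) (M : nat) :
  0 <= C -> (0 < M)%N -> (forall n, u n != 0) ->
  (forall n, (M <= n)%N -> N (u n.+1 - u n) <= N (u n) * (C / n%:R ^+ 2)) ->
  exists2 l : R[i], l != 0 &
    ((u : nat -> (R[i])^o) n @[n --> \oo] --> (l : (R[i])^o))%classic.
Proof.
move=> C0 M0 u0 uC.
(* From [M'] on the telescoped relative error [4 * C / n] is at most one half, so the sequence stays
   within a factor two of its value at [M'], both from above and from below. *)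
pose M' := maxn M (Num.truncn (8 * C)).+1.
have M'0 : (0 < M')%N by rewrite leq_max M0.
have CM n : (M' <= n)%N -> 8 * C <= n%:R.
  move=> Mn; apply/ltW/(lt_le_trans (truncnS_gt _)); rewrite ler_nat.
  exact: leq_trans (leq_maxr _ _) Mn.
have step n m : (M' <= n)%N -> (n <= m)%N ->
    N (u m - u n) <= N (u n) * (4 * C * (n%:R^-1 - m%:R^-1)).
  move=> Mn; elim: m => [|m IH].
    by rewrite leqn0 => /eqP ->; rewrite !subrr mulr0 mulr0 Normc.normc0.
  rewrite leq_eqVlt => /orP[/eqP <-|]; first by rewrite !subrr mulr0 mulr0 Normc.normc0.
  rewrite ltnS => nm; have {}IH := IH nm.
  have n0 : 0 < n%:R :> R by rewrite ltr0n; apply: leq_trans Mn.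
  have m0 : 0 < m%:R :> R by rewrite ltr0n; apply: leq_trans nm; apply: leq_trans Mn.
  have Mm : (M <= m)%N by apply: leq_trans nm; apply: leq_trans Mn; exact: leq_maxl.
  have um : N (u m) <= 2 * N (u n).
    have -> : u m = (u m - u n) + u n by ring.
    apply: le_trans (normc_triangle _ _) _.
    have Nn := normc_ge0 (u n).
    suff h : 4 * C * (n%:R^-1 - m%:R^-1) <= 1.
      have := ler_wpM2l Nn h; lra.
    have im : 0 <= m%:R^-1 :> R by rewrite invr_ge0 ltW.
    have h8 : 8 * C * n%:R^-1 <= 1 by rewrite -ler_pdivlMr ?invr_gt0 // div1r invrK CM.
    have := mulr_ge0 C0 im; lra.
  have -> : u m.+1 - u n = (u m.+1 - u m) + (u m - u n) by ring.
  apply: le_trans (normc_triangle _ _) _.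
  apply: le_trans (lerD (uC _ Mm) IH) _.
  have sq : C / m%:R ^+ 2 <= 2 * C * (m%:R^-1 - m.+1%:R^-1).
    rewrite -[m.+1%:R]natr1.
    have -> : 2 * C * (m%:R^-1 - (m%:R + 1)^-1) = C * (2 / (m%:R * (m%:R + 1))).
      by field; rewrite !lt0r_neq0 //; lra.
    apply: ler_wpM2l => //; rewrite -[leLHS]mul1r ler_pdivrMr ?exprn_gt0 //.
    have m1 : 1 <= m%:R :> R by rewrite ler1n -(ltr0n R).
    have -> : 2 / (m%:R * (m%:R + 1)) * m%:R ^+ 2 = 2 * m%:R / (m%:R + 1) :> R.
      by field; rewrite !lt0r_neq0 //; lra.
    by rewrite ler_pdivlMr; lra.
  have sq0 : 0 <= C / m%:R ^+ 2 by rewrite divr_ge0 // exprn_ge0 // ltW.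
  have := ler_pM (normc_ge0 (u m)) sq0 um sq.
  set a := m%:R^-1; set b := m.+1%:R^-1; set c := n%:R^-1; set d := N (u n); lra.
have le4 n m : (M' <= n)%N -> (n <= m)%N ->
    N (u m - u n) <= N (u n) * (4 * C / n%:R).
  move=> Mn nm; apply: le_trans (step _ _ Mn nm) _.
  apply: ler_wpM2l; first exact: normc_ge0.
  apply: ler_wpM2l; first lra.
  by rewrite gerBl invr_ge0.
have bnd n : (M' <= n)%N -> N (u n) <= 2 * N (u M').
  move=> Mn; have -> : u n = (u n - u M') + u M' by ring.
  apply: le_trans (normc_triangle _ _) _.
  have Nn := normc_ge0 (u M').
  have M0' : 0 < M'%:R^-1 :> R by rewrite invr_gt0 ltr0n.
  have h8 : 8 * C * M'%:R^-1 <= 1 by rewrite -ler_pdivlMr // div1r invrK CM.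
  have := le4 _ _ (leqnn M') Mn.
  have := mulr_ge0 Nn (ltW M0'); have := ler_wpM2l Nn h8.
  by set a := M'%:R^-1; set d := N (u M'); nra.
have [l lP] : exists l : R[i], forall n, (M' <= n)%N -> (0 < n)%N ->
    N (l - u n) <= 2 * (8 * C * N (u M')) / n%:R.
  apply: cauchy_dist_lim => n m Mn /andP[n0 nm].
  apply: le_trans (le4 _ _ Mn nm) _.
  rewrite mulrA; apply: ler_wpM2r; first by rewrite invr_ge0.
  have := bnd _ Mn; nra.
exists l; last exact: cvgc_of_dist lP.
apply/eqP => l0.
have half n : (M' <= n)%N -> N (u M') <= 2 * N (u n).
  move=> Mn; have := normc_triangle (u n) (u M' - u n).
  have -> : u n + (u M' - u n) = u M' by ring.
  rewrite (normc_dist (u M')) => tri.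
  have Nn := normc_ge0 (u M').
  have M0' : 0 < M'%:R^-1 :> R by rewrite invr_gt0 ltr0n.
  have h8 : 8 * C * M'%:R^-1 <= 1 by rewrite -ler_pdivlMr // div1r invrK CM.
  have := le4 _ _ (leqnn M') Mn.
  have := ler_wpM2l Nn h8.
  move: Nn tri; move: (N (u M')) (N (u n)) (N (u n - u M')) M'%:R^-1 => d x y a.
  by move=> d0 h1 h2 h3; have : d * (4 * C * a) = d * (8 * C * a) / 2 by [field]; lra.
(* If the limit were 0, the distance bound at [k] and [half] would give
   [N (u M') <= 32 * C * N (u M') / k], which is impossible for [k > 32 * C]. *)
pose k := maxn M' (Num.truncn (32 * C)).+1.
have k0 : 0 < k%:R :> R by rewrite ltr0n leq_max M'0.
have := lP k (leq_maxl _ _); rewrite -(ltr0n R) => /(_ k0).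
rewrite l0 sub0r normcN => h.
have h2 := half k (leq_maxl _ _).
have uM : 0 < N (u M') by rewrite normc_gt0.
have kC : 32 * C < k%:R.
  by apply: lt_le_trans (truncnS_gt _) _; rewrite ler_nat leq_maxr.
move: h; rewrite ler_pdivlMr // => h.
have := ltr_pM2l uM (32 * C) k%:R; rewrite kC => h3.
have := ler_wpM2r (ltW k0) h2; lra.
Qed.
End ComplexSequences.

(** * Second-order estimates for the complex exponential *)

Section ComplexGamma.
Variable R : realType.
Implicit Types (w : R[i]) (x t : R).

Local Notation N := (@Normc.normc R).

Lemma MVT_le1 (f df : R -> R) (K x : R) :
  (forall x, is_derive x (1 : R) f (df x)) ->
  (forall c, `|c| <= `|x| -> `|df c| <= K) -> `|f x - f 0| <= K * `|x|.
Proof.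
move=> dfP dfK.
have cf (a b : R) : {within `[a, b], continuous f}%classic.
  apply: derivable_within_continuous => y _; exact: (@ex_derive _ _ _ _ _ _ _ (dfP y)).
have [x0|x0] := leP 0 x.
  have [c /[!in_itv] /= /andP[c0 cx] ->] := MVT_segment x0 (fun y _ => dfP y) (cf 0 x).
  rewrite subr0 normrM; apply: ler_wpM2r => //; apply: dfK.
  by rewrite !ger0_norm // (le_trans c0).
have [c /[!in_itv] /= /andP[c0 cx] E] := MVT_segment (ltW x0) (fun y _ => dfP y) (cf x 0).
rewrite distrC E sub0r normrM normrN; apply: ler_wpM2r => //; apply: dfK.
by rewrite !ler0_norm ?lerN2 // (le_trans c0) // ltW.
Qed.

Lemma sin_norm_le x : `|sin x| <= `|x|.
Proof.
rewrite -[sin x]subr0 -{1}(@sin0 R) -[leRHS]mul1r.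
by apply: (MVT_le1 (fun y => is_derive_sin y)) => c _; exact: cos_max.
Qed.

Lemma cos_sub1_le x : `|cos x - 1| <= x ^+ 2.
Proof.
rewrite -{1}(@cos0 R) -real_normK ?num_real // expr2.
apply: (MVT_le1 (fun y => is_derive_cos y)) => c cx.
by rewrite normrN (le_trans (sin_norm_le c)).
Qed.

(** The lower bound is [1 + x <= expR x]; the same inequality at [- x] gives
    [expR x * (1 - x) <= 1], which yields the upper bound. *)
Lemma expR_sub1_le x : `|x| <= 1 / 2 -> `|expR x - 1 - x| <= 2 * x ^+ 2.
Proof.
move=> hx; have /andP[h1 h2] : - (1/2) <= x <= 1/2 by rewrite -ler_norml.
have g := expR_ge1Dx x; have g' := expR_ge1Dx (- x).
rewrite ger0_norm; last by lra.
have e0 := expR_gt0 x; have e1 : expR x * expR (- x) = 1 by rewrite -expRD subrr expR0.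
have : expR x * (1 - x) <= 1 by rewrite -[leRHS]e1; apply: ler_wpM2l; lra.
nra.
Qed.

Lemma sin_sub_le x : `|x| <= 1 -> `|sin x - x| <= x ^+ 2.
Proof.
move=> x1; rewrite -[sin x - x]subr0.
have -> : sin x - x - 0 = (sin x - x) - (sin (0 : R) - 0) by rewrite sin0 !subr0.
rewrite -real_normK ?num_real // expr2.
apply: (MVT_le1 (f := fun y => sin y - y) (df := fun y => cos y - 1)) => c cx.
apply: le_trans (cos_sub1_le _) _; rewrite -real_normK ?num_real //.
by rewrite expr2; have := normr_ge0 c; nra.
Qed.

(** This is exp(w t) for real [t], split into real and imaginary part; [natcpow n w] is its value at
    [t = ln n]. *)
Definition rcpow (w : R[i]) (t : R) : R[i] :=
  ((expR (complex.Re w * t) * cos (complex.Im w * t))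
   +i* (expR (complex.Re w * t) * sin (complex.Im w * t)))%C.

Lemma natcpowE n w : natcpow n w = rcpow w (ln n%:R).
Proof. by []. Qed.

Lemma rcpowD w s t : rcpow w (s + t) = rcpow w s * rcpow w t.
Proof.
rewrite /rcpow !mulrDr expRD cosD sinD; apply/eqP; rewrite eq_complex /=.
by apply/andP; split; apply/eqP; ring.
Qed.

Lemma rcpow_add1 w t : rcpow (w + 1) t = (expR t)%:C%C * rcpow w t.
Proof.
case: w => a b; rewrite /rcpow /= addr0 mulrDl mul1r expRD.
by apply/eqP; rewrite eq_complex /=; apply/andP; split; apply/eqP; ring.
Qed.

Lemma rcpow0 w : rcpow w 0 = 1.
Proof. by rewrite /rcpow !mulr0 expR0 cos0 sin0 mulr1 mulr0. Qed.

Lemma rcpow_neq0 w t : rcpow w t != 0.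
Proof.
apply/eqP => h; have := rcpowD w t (- t); rewrite subrr rcpow0 h mul0r.
by move/eqP; rewrite oner_eq0.
Qed.

(** Each coordinate of exp(wt) - 1 - tw is expanded so that every summand contains a second-order
    factor for exp, cos or sin. With [c = N w * t], the summands cost 2, 3/2, 1, 1 and 1 times
    [c ^+ 2]; the total is rounded up to 7. *)
Lemma rcpow_sub1_le w t : 0 <= t -> N w * t <= 1 / 2 ->
  N (rcpow w t - 1 - t%:C%C * w) <= 7 * N w ^+ 2 * t ^+ 2.
Proof.
move=> t0 wt.
have nt : `|t| = t by rewrite ger0_norm.
have Ra : `|complex.Re w * t| <= N w * t.
  by rewrite normrM nt ler_wpM2r // Re_le_normc.
have Ib : `|complex.Im w * t| <= N w * t.
  by rewrite normrM nt ler_wpM2r // Im_le_normc.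
apply: le_trans (normc_le_ReIm _) _.
have -> : 7 * N w ^+ 2 * t ^+ 2 = 7 * (N w * t) ^+ 2 by ring.
move: Ra Ib wt; case: w => x y /=; rewrite /rcpow /= !mul0r !subr0 addr0.
rewrite ![t * _]mulrC; set a := x * t; set b := y * t.
set c := _ * t => ac bc c2.
have ea := expR_sub1_le (le_trans ac c2).
have b1 : `|b| <= 1 by lra.
have cb := cos_sub1_le b; have sb := sin_sub_le b1.
have csb := cos_max b; have ssb := sin_norm_le b.
have c0 : 0 <= c by apply: le_trans ac.
have a2 : a ^+ 2 <= c ^+ 2 by rewrite -real_normK ?num_real // ler_pXn2r.
have b2 : b ^+ 2 <= c ^+ 2 by rewrite -real_normK ?num_real // ler_pXn2r.
have -> : expR a * cos b - 1 - a = (expR a - 1 - a) * cos b + (1 + a) * (cos b - 1) by ring.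
have -> : expR a * sin b - b = (expR a - 1 - a) * sin b + a * sin b + (sin b - b) by ring.
have cc : c ^+ 2 = c * c by rewrite expr2.
have p1 : `|(expR a - 1 - a) * cos b| <= 2 * c ^+ 2.
  by rewrite normrM -[leRHS]mulr1; apply: ler_pM => //; lra.
have p2 : `|(1 + a) * (cos b - 1)| <= 3 / 2 * c ^+ 2.
  rewrite normrM; apply: ler_pM => //; last lra.
  by apply: le_trans (ler_normD _ _) _; rewrite normr1; lra.
have p3 : `|(expR a - 1 - a) * sin b| <= (2 * c ^+ 2) * (1 / 2).
  by rewrite normrM; apply: ler_pM => //; lra.
have p4 : `|a * sin b| <= c * c.
  by rewrite normrM; apply: ler_pM => //; lra.
have {}sb : `|sin b - b| <= c ^+ 2 by apply: le_trans b2.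
have -> : 7 * c ^+ 2 = (2 * c ^+ 2 + 3 / 2 * c ^+ 2) + (2 * c ^+ 2 * (1 / 2) + c * c + c ^+ 2)
  + c ^+ 2 / 2 by field.
rewrite -[leLHS]addr0; apply: lerD; last by rewrite divr_ge0 ?sqr_ge0.
apply: lerD; first by apply: le_trans (ler_normD _ _) _; exact: lerD.
apply: le_trans (ler_normD _ _) _; apply: lerD => //.
by apply: le_trans (ler_normD _ _) _; exact: lerD.
Qed.
End ComplexGamma.

(** * Convergence of Euler's limit and the functional equation *)

Section GammaLimit.
Variable R : realType.
Implicit Types (w : R[i]) (x t : R).

Local Notation N := (@Normc.normc R).

Definition gamma_seq w (n : nat) : R[i] :=
  n`!%:R * natcpow n w / \prod_(0 <= j < n.+1) (w + j%:R).

Definition gamma_regular w := forall j : nat, w + j%:R != 0.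

Lemma gamma_seq_neq0 w n : gamma_regular w -> gamma_seq w n != 0.
Proof.
move=> wr; apply: mulf_neq0; [apply: mulf_neq0|rewrite invr_eq0].
- by rewrite pnatr_eq0 -lt0n fact_gt0.
- exact: rcpow_neq0.
- by rewrite prodf_seq_neq0; apply/allP => j _; exact: wr.
Qed.

Lemma gamma_seqS w n : gamma_regular w -> (0 < n)%N ->
  gamma_seq w n.+1 = gamma_seq w n *
    (n.+1%:R * rcpow w (ln n.+1%:R - ln n%:R) / (w + n.+1%:R)).
Proof.
move=> wr n0; rewrite /gamma_seq !natcpowE.
have -> : rcpow w (ln n.+1%:R) = rcpow w (ln n%:R) * rcpow w (ln n.+1%:R - ln n%:R).
  by rewrite -rcpowD; congr rcpow; ring.
rewrite (big_nat_recr n.+1) //= factS natrM invfM; ring.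
Qed.

(** Both sides are ln(1 + x) <= x, taken at x = -1/(n+1) and at x = 1/n. *)
Lemma ln_succ_bounds n : (0 < n)%N ->
  1 / n.+1%:R <= ln n.+1%:R - ln (n%:R : R) <= 1 / n%:R.
Proof.
move=> n0; have n0R : 0 < n%:R :> R by rewrite ltr0n.
have n1R : 0 < n%:R + 1 :> R by lra.
have e1 : n.+1%:R = n%:R + 1 :> R by rewrite natr1.
apply/andP; split.
  have : ln (1 + (- (1 / n.+1%:R))) <= - (1 / n.+1%:R) :> R.
    by apply: le_ln1Dx; rewrite e1 ltrN2 ltr_pdivrMr //; lra.
  have -> : 1 + - (1 / n.+1%:R) = n%:R * n.+1%:R^-1 :> R.
    by rewrite e1; field; rewrite lt0r_neq0.
  by rewrite lnM ?posrE ?invr_gt0 ?e1 // lnV ?posrE //; lra.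
have : ln (1 + 1 / n%:R) <= 1 / n%:R :> R.
  apply: le_ln1Dx; apply: (@lt_le_trans _ _ 0); first lra.
  by rewrite divr_ge0 // ltW.
have -> : 1 + 1 / n%:R = n.+1%:R * n%:R^-1 :> R.
  by rewrite e1; field; rewrite lt0r_neq0.
by rewrite lnM ?posrE ?invr_gt0 ?e1 // lnV ?posrE.
Qed.

(** With t = ln(n+1) - ln n, the numerator of the ratio minus one is (n+1)(exp(wt) - 1 - tw) +
    w((n+1)t - 1). The first-order terms have cancelled: both summands are O(1/n), and the
    denominator is at least n/2. *)
Lemma gamma_ratio_bound w : gamma_regular w ->
  exists C : R, exists M : nat, [/\ 0 <= C, (0 < M)%N &
    forall n, (M <= n)%N ->
      N (n.+1%:R * rcpow w (ln n.+1%:R - ln n%:R) / (w + n.+1%:R) - 1)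
        <= C / n%:R ^+ 2].
Proof.
move=> wr.
have W0 := normc_ge0 w.
exists (2 * (14 * N w ^+ 2 + N w)); exists (Num.truncn (2 * N w)).+1.
split=> //; first by have := sqr_ge0 (N w); lra.
move=> n Mn.
have n0 : (0 < n)%N by apply: leq_trans Mn.
have n1 : 1 <= n%:R :> R by rewrite ler1n.
have n0R : 0 < n%:R :> R by rewrite ltr0n.
have W2 : 2 * N w <= n%:R.
  by apply/ltW/(lt_le_trans (truncnS_gt _)); rewrite ler_nat.
have /andP[lo hi] := ln_succ_bounds n0.
set t := ln n.+1%:R - ln n%:R in lo hi *.
have e1 : n.+1%:R = n%:R + 1 :> R by rewrite natr1.
have t0 : 0 <= t by apply: le_trans lo; rewrite divr_ge0.
have Wt : N w * t <= 1 / 2.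
  apply: le_trans (ler_wpM2l W0 hi) _.
  by rewrite mulrA mulr1 ler_pdivrMr //; lra.
have b := rcpow_sub1_le t0 Wt.
have dn : w + n.+1%:R != 0 by exact: wr.
have -> : n.+1%:R * rcpow w t / (w + n.+1%:R) - 1
  = (n.+1%:R * (rcpow w t - 1 - t%:C%C * w) + w * real_complex R (n.+1%:R * t - 1))
    / (w + n.+1%:R).
  clearbody t; rewrite (rmorphB (real_complex R)) (rmorphM (real_complex R)) (rmorph1 (real_complex R)).
  rewrite (rmorph_nat (real_complex R)).
  by move: (n.+1%:R : R[i]) dn => p dn; field.
rewrite Normc.normcM Normc.normcV.
have Nd : n%:R / 2 <= N (w + n.+1%:R).
  have := normc_triangle (w + n.+1%:R) (- w).
  have -> : w + n.+1%:R - w = n.+1%:R by ring.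
  have -> : N (- w) = N w by exact: normcN.
  by rewrite normc_nat e1; lra.
have Nd0 : 0 < N (w + n.+1%:R) by apply: lt_le_trans Nd; rewrite divr_gt0.
rewrite ler_pdivrMr //.
have num : N (n.+1%:R * (rcpow w t - 1 - t%:C%C * w) + w * real_complex R (n.+1%:R * t - 1))
    <= (14 * N w ^+ 2 + N w) / n%:R.
  apply: le_trans (normc_triangle _ _) _.
  rewrite !Normc.normcM normc_nat normc_real mulrDl; apply: lerD.
    have : n.+1%:R * N (rcpow w t - 1 - t%:C%C * w)
        <= (2 * n%:R) * (7 * N w ^+ 2 * (1 / n%:R) ^+ 2).
      apply: ler_pM => //; first exact: normc_ge0.
        by rewrite e1; lra.
      apply: le_trans b _; apply: ler_wpM2l; first by rewrite mulr_ge0 ?sqr_ge0.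
      by rewrite ler_pXn2r // nnegrE // divr_ge0 // ltW.
    move=> h; apply: le_trans h _; rewrite le_eqVlt; apply/orP; left; apply/eqP.
    by field; rewrite lt0r_neq0.
  apply: ler_wpM2l => //.
  have lo' : 1 <= n.+1%:R * t.
    by move: lo; rewrite ler_pdivrMr ?ltr0n // mulrC.
  rewrite ger0_norm ?subr_ge0 // lerBlDr.
  have -> : n%:R^-1 + 1 = n.+1%:R * (1 / n%:R) :> R.
    by rewrite e1; field; rewrite lt0r_neq0.
  exact: ler_wpM2l.
apply: le_trans num _.
have -> : (14 * N w ^+ 2 + N w) / n%:R
  = 2 * (14 * N w ^+ 2 + N w) / n%:R ^+ 2 * (n%:R / 2).
  by field; rewrite lt0r_neq0.
apply: ler_wpM2l => //; rewrite divr_ge0 ?sqr_ge0 //.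
by have := sqr_ge0 (N w); lra.
Qed.

Lemma gamma_seq_cvg w : gamma_regular w ->
  exists2 l : R[i], l != 0 &
    ((gamma_seq w : nat -> (R[i])^o) n @[n --> \oo] --> (l : (R[i])^o))%classic.
Proof.
move=> wr; have [C [M [C0 M0 CM]]] := gamma_ratio_bound wr.
apply: (ratio_quadratic_cvg C0 M0) => [n|n Mn]; first exact: gamma_seq_neq0.
have n0 : (0 < n)%N by apply: leq_trans Mn.
rewrite gamma_seqS //; set r := _ / _.
have -> : gamma_seq w n * r - gamma_seq w n = gamma_seq w n * (r - 1) by ring.
rewrite Normc.normcM; apply: ler_wpM2l; [exact: normc_ge0 | exact: CM].
Qed.

Lemma cvgc_unique (u : nat -> R[i]) (l : R[i]) :
  ((u : nat -> (R[i])^o) n @[n --> \oo] --> (l : (R[i])^o))%classic ->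
  limn (u : nat -> (R[i])^o) = l.
Proof. by move=> ul; apply: cvg_lim ul; exact: norm_hausdorff. Qed.

Lemma cGamma_neq0 w : gamma_regular w -> cGamma w != 0.
Proof.
move=> /gamma_seq_cvg[l l0 ul].
by rewrite (_ : cGamma w = l) //; exact: cvgc_unique.
Qed.

Lemma natr_ratio_cvg1 w :
  ((fun n : nat => n%:R / (w + n.+1%:R) : (R[i])^o) n @[n --> \oo]
     --> (1 : (R[i])^o))%classic.
Proof.
apply: (@cvgc_of_dist _ _ _ (2 * N (w + 1)) (Num.truncn (2 * N w)).+1) => n Mn n0.
have n0R : 0 < n%:R :> R by rewrite ltr0n.
have W2 : 2 * N w <= n%:R.
  by apply/ltW/(lt_le_trans (truncnS_gt _)); rewrite ler_nat.
have e1 : n.+1%:R = n%:R + 1 :> R by rewrite natr1.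
have Nd : n%:R / 2 <= N (w + n.+1%:R).
  have := normc_triangle (w + n.+1%:R) (- w).
  have -> : w + n.+1%:R - w = n.+1%:R by ring.
  have -> : N (- w) = N w by exact: normcN.
  by rewrite normc_nat e1; lra.
have Nd0 : 0 < N (w + n.+1%:R) by apply: lt_le_trans Nd; rewrite divr_gt0.
have d0 : w + n.+1%:R != 0 by rewrite -normc_gt0.
have -> : 1 - n%:R / (w + n.+1%:R) = (w + 1) / (w + n.+1%:R).
  by move: d0; rewrite -[n.+1%:R]natr1 => d0; field.
rewrite Normc.normcM Normc.normcV ler_pdivrMr //.
have -> : 2 * N (w + 1) / n%:R * N (w + n.+1%:R)
  = N (w + 1) * (2 / n%:R * N (w + n.+1%:R)) by ring.
rewrite -[leLHS]mulr1; apply: ler_wpM2l; first exact: normc_ge0.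
apply: (@le_trans _ _ (2 / n%:R * (n%:R / 2))).
  by rewrite le_eqVlt; apply/orP; left; apply/eqP; field; rewrite lt0r_neq0.
by apply: ler_wpM2l => //; rewrite divr_ge0 // ltW.
Qed.

(** At finite level, term [n] for [w + 1] is [w] times term [n] for [w], times n/(w+n+1), and this
    last factor tends to 1. *)
Lemma cGammaS w : gamma_regular w -> cGamma (w + 1) = w * cGamma w.
Proof.
move=> wr; have [l l0 ul] := gamma_seq_cvg wr.
rewrite (_ : cGamma w = l); last exact: cvgc_unique.
apply: cvgc_unique.
suff h : ((fun n => w * gamma_seq w n * (n%:R / (w + n.+1%:R)) : (R[i])^o) n
    @[n --> \oo] --> (w * l * 1 : (R[i])^o))%classic.
  rewrite -[w * l]mulr1; apply: cvg_trans h; apply: near_eq_cvg.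
  (* The index 0 is excluded because [expR (ln n)] equals [n] only for positive [n]. *)
  exists 1%N => // n /= n0; rewrite /gamma_seq !natcpowE rcpow_add1 lnK ?posrE ?ltr0n //.
  rewrite rmorph_nat.
  have -> : \prod_(0 <= j < n.+1) (w + 1 + j%:R)
     = (\prod_(0 <= j < n.+1) (w + j%:R)) * (w + n.+1%:R) / w.
    have w0 := wr 0%N; rewrite addr0 in w0.
    apply: (mulIf w0); rewrite mulfVK //.
    rewrite -(big_nat_recr n.+1) //= [RHS]big_nat_recl //= addr0 mulrC; congr (_ * _).
    by apply: eq_bigr => j _; rewrite -[j.+1%:R]natr1; ring.
  by rewrite !invfM invrK; ring.
apply: (@cvgM R[i]); last exact: natr_ratio_cvg1.
by apply: (@cvgM R[i]) => //; exact: cvg_cst.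
Qed.

Lemma cGamma1 : cGamma (1 : R[i]) = 1.
Proof.
apply: cvgc_unique; apply: cvg_trans (natr_ratio_cvg1 0); apply: near_eq_cvg.
exists 1%N => // n /= n0; rewrite add0r natcpowE.
rewrite (_ : rcpow 1 (ln n%:R) = rcpow (0 + 1) (ln n%:R) :> R[i]); last by rewrite add0r.
rewrite rcpow_add1.
rewrite lnK ?posrE ?ltr0n // rmorph_nat.
have -> : rcpow 0 (ln n%:R) = 1 :> R[i] by rewrite /rcpow /= !mul0r expR0 cos0 sin0 mulr1 mulr0.
have -> : \prod_(0 <= j < n.+1) (1 + j%:R) = (n.+1)`!%:R :> R[i].
  elim: n {n0} => [|n IH]; first by rewrite big_nat1 addr0.
  by rewrite big_nat_recr //= IH [(n.+2)`!]factS natrM mulrC nat1r.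
rewrite factS natrM invfM mulr1; set f := n`!%:R.
have f0 : f != 0 :> R[i] by rewrite pnatr_eq0 -lt0n fact_gt0.
have n1 : n.+1%:R != 0 :> R[i] by rewrite pnatr_eq0.
by move: (n.+1%:R : R[i]) n1 => p p0; field; rewrite f0 p0.
Qed.

End GammaLimit.

(** * Multiplicative characters of K-theory *)

Section MultiplicativeExtension.
Variable F : fieldType.

(** [euler_gen] is the instance [c := efac P \o _], up to conversion. For nonvanishing [c] it is a
    homomorphism to the multiplicative group; a zero value would break this whenever coefficients
    cancel, which is why zero weights are carried by [e1]. *)
Definition mprod (X : choiceType) (c : X -> F) (D : {freeg X / int}) : F :=
  \prod_(x <- dom D) c x ^ coeff x D.

Section Single.
Variables (X : choiceType) (c : X -> F).
Hypothesis c0 : forall x, c x != 0.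
Implicit Types D E : {freeg X / int}.

Lemma mprod_sub (s : seq X) D : uniq s -> {subset dom D <= s} ->
  mprod c D = \prod_(x <- s) c x ^ coeff x D.
Proof.
move=> us sub; rewrite (bigID (mem (dom D))) /= [X in _ * X]big1; last first.
  by move=> x xD; rewrite coeff_outdom // expr0z.
rewrite mulr1 -big_filter; apply: perm_big; apply: uniq_perm.
- exact: uniq_dom.
- exact: filter_uniq.
- by move=> x; rewrite mem_filter andb_idr // => /sub.
Qed.

Lemma mprod_neq0 D : mprod c D != 0.
Proof. by rewrite prodf_seq_neq0; apply/allP => x _; rewrite expfz_neq0. Qed.

Lemma mprod0 : mprod c 0 = 1.
Proof. by rewrite /mprod dom0 big_nil. Qed.

Lemma mprodD D E : mprod c (D + E) = mprod c D * mprod c E.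
Proof.
pose s := undup (dom D ++ dom E).
have us : uniq s by exact: undup_uniq.
rewrite (mprod_sub us) => [|x /domD_subset]; last by rewrite mem_undup.
rewrite [mprod c D](mprod_sub us) => [|x xD]; last by rewrite mem_undup mem_cat xD.
rewrite [mprod c E](mprod_sub us) => [|x xE]; last by rewrite mem_undup mem_cat xE orbT.
by rewrite -big_split; apply: eq_bigr => x _; rewrite coeffD expfzDr.
Qed.

Lemma mprodN D : mprod c (- D) = (mprod c D)^-1.
Proof.
apply: (mulIf (mprod_neq0 D)).
by rewrite -mprodD addNr mprod0 mulVf ?mprod_neq0.
Qed.

Lemma mprodU x : mprod c << x >> = c x.
Proof. by rewrite /mprod domU1 big_seq1 coeffU eqxx mulr1 expr1z. Qed.

Lemma mprod_sum (I : Type) (r : seq I) (D : I -> {freeg X / int}) :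
  mprod c (\sum_(i <- r) D i) = \prod_(i <- r) mprod c (D i).
Proof. exact: (big_morph _ mprodD mprod0). Qed.

Lemma mprodZ (k : int) D : mprod c (k *: D) = mprod c D ^ k.
Proof.
rewrite (@mprod_sub (dom D)) ?uniq_dom //; last exact: domZ_subset.
rewrite /mprod (big_morph (fun x => x ^ k) (fun x y => expfzMl x y k) (exp1rz _ _)).
by apply: eq_bigr => x _; rewrite coeffZ mulrC exprz_exp.
Qed.
End Single.

Lemma fglift0 (X : choiceType) (M : lmodType int) (f : X -> M) : fglift f 0 = 0.
Proof. by rewrite -[in LHS](subrr 0) lift_is_additive subrr. Qed.

Lemma fgliftD (X : choiceType) (M : lmodType int) (f : X -> M) :
  {morph fglift f : D E / D + E}.
Proof.
move=> D E; rewrite -[E in LHS]opprK lift_is_additive -[- E]sub0r lift_is_additive.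
by rewrite fglift0 sub0r opprK.
Qed.

Lemma fglift_sum (X : choiceType) (M : lmodType int) (f : X -> M) (I : Type) (r : seq I)
    (D : I -> {freeg X / int}) :
  fglift f (\sum_(i <- r) D i) = \sum_(i <- r) fglift f (D i).
Proof. exact: (big_morph _ (fgliftD f) (fglift0 f)). Qed.

Lemma mprod_fglift (X Y : choiceType) (c : Y -> F) (f : X -> {freeg Y / int}) D :
  (forall y, c y != 0) ->
  mprod c (fglift f D) = mprod (fun x => mprod c (f x)) D.
Proof.
move=> c0; rewrite -[in LHS](freeg_sumE D) fglift_sum (mprod_sum c0).
by apply: eq_bigr => x _; rewrite liftU mprodZ.
Qed.

Lemma mprod_fgmap (X Y : choiceType) (c : Y -> F) (f : X -> Y) D :
  (forall y, c y != 0) ->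
  mprod c (Defs.fgmap f D) = mprod (c \o f) D.
Proof.
move=> c0; rewrite mprod_fglift //; apply: eq_bigr => x _.
by rewrite mprodU.
Qed.

Lemma eq_mprod (X : choiceType) (c c' : X -> F) D : c =1 c' -> mprod c D = mprod c' D.
Proof. by move=> cc; apply: eq_bigr => x _; rewrite cc. Qed.

Lemma mprodM (X : choiceType) (c c' : X -> F) D :
  mprod (fun x => c x * c' x) D = mprod c D * mprod c' D.
Proof. by rewrite -big_split; apply: eq_bigr => x _; rewrite expfzMl. Qed.

Lemma mprod_cst (X : choiceType) (a : F) (D : {freeg X / int}) : a != 0 ->
  mprod (fun=> a) D = a ^ freeg.deg D.
Proof.
move=> a0; have -> : freeg.deg D = \sum_(x <- dom D) coeff x D.
  rewrite -[in LHS](freeg_sumE D) /freeg.deg fglift_sum; apply: eq_bigr => x _.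
  exact: degU.
by rewrite (big_morph (fun k : int => a ^ k) (fun k l => expfzDr k l a0) (expr0z a)).
Qed.
End MultiplicativeExtension.

Lemma morphMz (U W : zmodType) (f : U -> W) : {morph f : x y / x + y} ->
  forall x (k : int), f (x *~ k) = f x *~ k.
Proof.
move=> fD.
have f0 : f 0 = 0 by apply: (@addrI _ (f 0)); rewrite -fD !addr0.
have fN x : f (- x) = - f x by apply/eqP; rewrite -addr_eq0 -fD addNr f0.
have fMn x (m : nat) : f (x *+ m) = f x *+ m.
  by elim: m => [|m IH]; rewrite ?f0 // !mulrS fD IH.
by move=> x [m|m]; rewrite ?NegzE ?mulrNz ?fN -!pmulrn fMn.
Qed.

(** * Telescoping over the weights of the cohomology of a line bundle *)

Section EquivariantGamma.
Variables (R : realType) (P : eqparam R).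
Local Notation h := (hbar P).
Local Notation G := (Gamma2h P).

Lemma c1D a b : c1 P (a + b) = c1 P a + c1 P b.
Proof.
rewrite /c1 addrACA -mulrzDr -big_split; congr (_ + _).
by apply: eq_bigr => k _; rewrite ffunE mulrzDr.
Qed.

Lemma c1N a : c1 P (- a) = - c1 P a.
Proof.
rewrite /c1 opprD mulrNz -sumrN; congr (_ + _).
by apply: eq_bigr => k _; rewrite ffunE mulrNz.
Qed.

Lemma c1Mz a (m : int) : c1 P (a *~ m) = c1 P a *~ m.
Proof. exact: (morphMz c1D). Qed.

Lemma c1_qchar : c1 P qchar = - h.
Proof.
by rewrite /c1 big1 ?add0r // => k _; rewrite ffunE mulr0z.
Qed.

Section Telescope.
Variables (f g : R[i] -> R[i]) (a : R[i]).
Hypotheses (f0 : forall x, f x != 0) (g0 : forall x, g x != 0) (a0 : a != 0).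
Hypothesis fg : forall x, f x * g x = a * g (x + 2 * h).

Let fE x : f x = a * (g (x + 2 * h) / g x).
Proof. by apply: (mulIf (g0 x)); rewrite fg mulrA mulfVK. Qed.

(* For [L] of degree [d >= 0], the weights of [chi_line L] are the arithmetic
   progression from [y] down to [y - 2 d h] in steps of [2 h]. *)
Lemma mprod_chi_line (L : PicT) (y := c1 P L.2 + L.1%:~R * h) :
  mprod (fun x => f (c1 P x)) (chi_line L)
  = a ^ (L.1 + 1) * (g (y + 2 * h) / g (y - 2 * L.1%:~R * h)).
Proof.
have c0 x : f (c1 P x) != 0 by exact: f0.
have w (b c : int) : c1 P (L.2 + qchar *~ (b - c)) = c1 P L.2 - (b - c)%:~R * h.
  by rewrite c1D c1Mz c1_qchar -mulrzr mulNr [h * _]mulrC.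
rewrite /chi_line /y; case: L w {y} => [[d|n] x] /= w.
  rewrite mprod_sum //.
  have -> : Posz d + 1 = d.+1%:Z by lia.
  rewrite -exprnP.
  have -> : \prod_(0 <= b < d.+1) mprod (fun x => f (c1 P x)) << x + qchar *~ (b%:Z - (d - b)%N%:Z) >>
      = \prod_(0 <= b < d.+1) f (c1 P x + d%:~R * h - 2 * b%:R * h).
    apply: eq_big_nat => b /andP[_ bd]; rewrite mprodU // w; congr f.
    by rewrite -subzn // !rmorphB /= -!pmulrn; ring.
  set y := c1 P x + _.
  (* In terms of the number [d.+1] of weights, the induction can start from the empty
     progression. *)
  have -> : 2 * d%:~R * h = 2 * d.+1%:R * h - 2 * h by rewrite -pmulrn -natr1; ring.
  elim: d.+1 => [|m IH].
    by rewrite big_nil expr0 mul1r mulr0 mul0r sub0r opprK divff.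
  rewrite big_nat_recr //= IH fE exprSr.
  have -> : y - 2 * m%:R * h + 2 * h = y - (2 * m%:R * h - 2 * h) by ring.
  have -> : 2 * m.+1%:R * h - 2 * h = 2 * m%:R * h by rewrite -natr1; ring.
  by field; rewrite !g0.
rewrite mprodN // mprod_sum //.
have -> : Negz n + 1 = - n%:Z by lia.
rewrite -exprnN.
have -> : \prod_(0 <= b < n) mprod (fun x => f (c1 P x)) << x + qchar *~ ((n - b)%N%:Z - b.+1%:Z) >>
    = \prod_(0 <= b < n) f (c1 P x + (Negz n)%:~R * h + 2 * h + 2 * b%:R * h).
  apply: eq_big_nat => b /andP[_ bn]; rewrite mprodU // w; congr f.
  rewrite -subzn ?(ltnW bn) // NegzE !rmorphB rmorphN /= -!pmulrn -!natr1; ring.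
have -> : c1 P x + (Negz n)%:~R * h - 2 * (Negz n)%:~R * h
   = c1 P x + (Negz n)%:~R * h + 2 * h + 2 * n%:R * h.
  by rewrite NegzE rmorphN /= -pmulrn -natr1; ring.
rewrite -[RHS]invrK; congr (_^-1); rewrite invfM invrK invf_div.
move: (c1 P x + (Negz n)%:~R * h + 2 * h) => y.
elim: n {w} => [|m IH].
  by rewrite big_nil expr0 mul1r mulr0 mul0r addr0 divff.
rewrite big_nat_recr //= IH fE exprSr.
have -> : y + 2 * m%:R * h + 2 * h = y + 2 * m.+1%:R * h by rewrite -natr1; ring.
by field; rewrite !g0.
Qed.
End Telescope.
End EquivariantGamma.

(** * Gamma functions and zero weights *)

Section GammaRecursion.
Variables (R : realType) (P : eqparam R).
Hypotheses (h0 : hbar P != 0) (e10 : e1 P != 0).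
Local Notation h := (hbar P).
Local Notation G := (Gamma2h P).

Definition gamma_pole (x : R[i]) : Prop := exists d : nat, x = - (2 * d%:R * h).

Definition zero_weight (a x : R[i]) : R[i] := if x == 0 then a else 1.

(** Its inverse takes the place of Gamma in the telescoping: only the poles are recorded, each with
    weight [a]. *)
Definition pole_weight (a x : R[i]) : R[i] := if `[< gamma_pole x >] then a else 1.

Lemma two_h_neq0 : 2 * h != 0.
Proof. by rewrite mulf_neq0 // pnatr_eq0. Qed.

Lemma two_h_nat_inj (c d : nat) : 2 * c%:R * h = 2 * d%:R * h -> c = d.
Proof.
move/(mulIf h0)/mulfI; rewrite pnatr_eq0 => /(_ isT) /eqP.
by rewrite eqr_nat => /eqP.
Qed.

Lemma gamma_pole_succ x : gamma_pole (x + 2 * h) <-> gamma_pole x /\ x <> 0.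
Proof.
split=> [[d dE]|[[[|d] dE] x0]].
- split; first by exists d.+1; rewrite -(addrK (2 * h) x) dE -natr1; ring.
  move=> x0; move: dE; rewrite x0 add0r => dE.
  have : 2 * (d.+1)%:R * h = 2 * 0%:R * h.
    have -> : 2 * (d.+1)%:R * h = 2 * d%:R * h + 2 * h by rewrite -natr1; ring.
    by rewrite dE; ring.
  by move/two_h_nat_inj.
- by case: x0; rewrite dE mulr0 mul0r oppr0.
- by exists d; rewrite dE -natr1; ring.
Qed.

Lemma Gamma2h_pole (d : nat) : G (- (2 * d%:R * h)) = (-1) ^+ d / d`!%:R * (e1 P)^-1.
Proof.
rewrite /Gamma2h; case: pselect => [p|[]]; last by exists d.
case: (cid p) => d' /= /oppr_inj/two_h_nat_inj ->.
by [].
Qed.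

Lemma Gamma2h_regular x : ~ gamma_pole x -> G x = cGamma (x / (2 * h)).
Proof. by move=> px; rewrite /Gamma2h; case: pselect. Qed.

Lemma gamma_regular_scale x : ~ gamma_pole x -> gamma_regular (x / (2 * h)).
Proof.
move=> px j; apply/eqP => xj; apply: px; exists j.
have -> : x = (x / (2 * h) + j%:R) * (2 * h) - 2 * j%:R * h.
  by rewrite mulrDl divfK ?two_h_neq0 //; ring.
by rewrite xj mul0r sub0r.
Qed.

Lemma Gamma2h_neq0 x : G x != 0.
Proof.
have [[d ->]|px] := pselect (gamma_pole x).
  have df : d`!%:R != 0 :> R[i] by rewrite pnatr_eq0 -lt0n fact_gt0.
  by rewrite Gamma2h_pole !mulf_eq0 !invr_eq0 signr_eq0 (negPf df) (negPf e10).
by rewrite Gamma2h_regular //; apply/cGamma_neq0/gamma_regular_scale.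
Qed.

Lemma efac_neq0 x : efac P x != 0.
Proof. by rewrite /efac; case: ifPn. Qed.

Lemma zero_weight_neq0 a x : a != 0 -> zero_weight a x != 0.
Proof. by move=> a0; rewrite /zero_weight; case: ifP; rewrite ?oner_eq0. Qed.

Lemma pole_weight_neq0 a x : a != 0 -> pole_weight a x != 0.
Proof. by move=> a0; rewrite /pole_weight; case: ifP; rewrite ?oner_eq0. Qed.

(* [Gamma_{2h}(0)] is read as [1 / e1] although [Gamma(x / 2h)] has residue [2 h]
   at [0]: this is the origin of the extra factor [2 h] at a zero weight. *)
Lemma Gamma2h_rec x :
  efac P x * zero_weight (2 * h) x * G x = 2 * h * G (x + 2 * h).
Proof.
have reg1 : ~ gamma_pole (2 * h) by rewrite -[2 * h]add0r => /gamma_pole_succ[].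
rewrite /efac /zero_weight; case: eqVneq => [->|x0].
  rewrite add0r (Gamma2h_regular reg1) divff ?two_h_neq0 // cGamma1.
  have := Gamma2h_pole 0; rewrite mulr0 mul0r oppr0 expr0 fact0 divr1 mul1r => ->.
  by field.
rewrite mulr1.
have [px|px] := pselect (gamma_pole x); last first.
  have px1 : ~ gamma_pole (x + 2 * h) by move=> /gamma_pole_succ[].
  rewrite (Gamma2h_regular px) (Gamma2h_regular px1).
  have -> : (x + 2 * h) / (2 * h) = x / (2 * h) + 1 by field.
  rewrite cGammaS; last exact: gamma_regular_scale.
  by rewrite mulrA [2 * h * _]mulrC mulfVK ?two_h_neq0.
case: px x0 => -[|d] -> x0; first by rewrite mulr0 mul0r oppr0 eqxx in x0.
have -> : - (2 * d.+1%:R * h) + 2 * h = - (2 * d%:R * h) by rewrite -natr1; ring.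
rewrite !Gamma2h_pole factS natrM exprS.
have d1 : d.+1%:R != 0 :> R[i] by rewrite pnatr_eq0.
have df : d`!%:R != 0 :> R[i] by rewrite pnatr_eq0 -lt0n fact_gt0.
by move: (d.+1%:R : R[i]) (d`!%:R : R[i]) d1 df => p q p0 q0; field; rewrite e10 p0 q0.
Qed.

(** Moving up by [2 * h] keeps a pole a pole except at 0, where the progression of poles ends; this
    one exception is the zero weight being counted. *)
Lemma zero_weight_rec a x : a != 0 ->
  zero_weight a x * (pole_weight a x)^-1 = 1 * (pole_weight a (x + 2 * h))^-1.
Proof.
move=> a0; rewrite mul1r /zero_weight /pole_weight; case: eqVneq => [->|x0].
  have p0 : gamma_pole 0 by exists 0%N; rewrite mulr0 mul0r oppr0.
  have p1 : ~ gamma_pole (0 + 2 * h) by move=> /gamma_pole_succ[].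
  by rewrite (asboolT p0) (asboolF p1) mulfV // invr1.
rewrite mul1r; congr (if _ then _ else _)^-1.
apply/asbool_equiv_eq; split => [px|/gamma_pole_succ[]//].
by apply/gamma_pole_succ; split=> //; apply/eqP.
Qed.
End GammaRecursion.

(** * Zero weights in the cohomology of a single line bundle *)

Section ZeroWeights.
Variables (R : realType) (P : eqparam R) (sigma : 'I_3 -> int).
Hypotheses (hP : generic P) (hsigma : \sum_(k < 3) sigma k = 2).
Local Notation h := (hbar P).

Lemma generic_e1 : e1 P != 0. Proof. by case: hP. Qed.

Lemma generic_h : h != 0.
Proof.
case: hP => _ _ gen; apply/eqP => h0.
have : c1 P qchar = 0 by rewrite c1_qchar h0 oppr0.
by move/gen => [].
Qed.

Lemma c1_eq0 (v : 'I_3 -> int) (e : int) :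
  c1 P ([ffun k => v k], e) = 0 <-> (exists c, forall k, v k = c) /\ e = 0.
Proof.
case: hP => hb0 _ gen; split=> [/gen [vv e0]|[[c vc] ->]].
  by split=> //; exists (v ord0) => k; have := vv k ord0; rewrite !ffunE.
rewrite /c1 /= mulr0z addr0.
transitivity ((\sum_(k < 3) hb P k) *~ c); last by rewrite hb0 mul0rz.
rewrite -mulrzl mulr_sumr; by apply: eq_bigr => k _; rewrite ffunE vc mulrzl.
Qed.

(** Adding [2 * d * h] lowers the q-exponent by [2 * d], so being a pole means that some such shift
    has zero Chern class, which genericity decides. *)
Lemma gamma_pole_c1 (v : 'I_3 -> int) (e : int) :
  gamma_pole P (c1 P ([ffun k => v k], e)) <->
  (exists c, forall k, v k = c) /\ exists d : nat, e = 2 * d%:Z.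
Proof.
have shift (d : nat) : c1 P ([ffun k => v k], e - 2 * d%:Z)
    = c1 P ([ffun k => v k], e) + 2 * d%:R * h.
  rewrite /c1 /c1q /= -addrA; congr (_ + _).
  by rewrite mulrzBr !mulNrz opprK -(mulrzr h (2 * _)) rmorphM /= -pmulrn; ring.
split=> [[d dE]|[vc [d dE]]].
  have : c1 P ([ffun k => v k], e - 2 * d%:Z) = 0 by rewrite shift dE addNr.
  by move/c1_eq0 => [vc e0]; split=> //; exists d; apply/eqP; rewrite -subr_eq0 e0.
exists d; apply/eqP; rewrite -subr_eq0 opprK -shift; apply/eqP/c1_eq0.
by rewrite dE subrr.
Qed.

(* ell v zeta is the line bundle [t^(-v) q^zeta O(zeta + <sigma, v>)]. *)
Definition ell (v : 'I_3 -> int) (zeta : int) : PicT :=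
  (zeta + \sum_(k < 3) sigma k * v k, ([ffun k => - v k], zeta)).

(** For [v = (c,c,c)] the q-exponents of the cohomology lie between [- 2 * c] and [2 * (zeta + c)].
    The two ends are poles according to the signs of [c] and [zeta + c]; as these agree, exactly one
    zero weight occurs, in H^0 for [c >= 0] and in H^1 otherwise. *)
Lemma zero_count_ell (a : R[i]) (v : 'I_3 -> int) (zeta : int) : a != 0 ->
  (forall c, (forall k, v k = c) -> (0 <= zeta + c) = (0 <= c)) ->
  mprod (fun x => zero_weight a (c1 P x)) (chi_line (ell v zeta)) = a ^ diagsgn v.
Proof.
move=> a0 vz.
have pw0 x : (pole_weight P a x)^-1 != 0 by rewrite invr_eq0 pole_weight_neq0.
rewrite (mprod_chi_line (fun x => zero_weight_neq0 x a0) pw0 (oner_neq0 _)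
  (fun x => zero_weight_rec generic_h x a0)).
rewrite exp1rz mul1r invrK /=.
set s := \sum_(k < 3) _.
have yE (e : int) : c1 P ([ffun k => - v k], zeta) + (zeta + s)%:~R * h - e%:~R * h
    = c1 P ([ffun k => - v k], e - s).
  by rewrite /c1 /c1q /= -(mulrzr _ (e - s)) -(mulrzr _ zeta) rmorphD rmorphB /=; ring.
have -> : c1 P ([ffun k => - v k], zeta) + (zeta + s)%:~R * h + 2 * h
    = c1 P ([ffun k => - v k], - 2 - s).
  by rewrite -yE rmorphN /=; ring.
have -> : 2 * (zeta + s)%:~R * h = (2 * (zeta + s))%:~R * h by rewrite rmorphM.
rewrite yE /pole_weight.
have pole e : `[< gamma_pole P (c1 P ([ffun k => - v k], e - s)) >]
    = `[< (exists c, forall k, v k = c) /\ exists d : nat, e - s = 2 * d%:Z >].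
  apply/asbool_equiv_eq; split.
    move/(@gamma_pole_c1 (fun k => - v k)) => [[c vc] de]; split=> //.
    by exists (- c) => k; rewrite -(vc k) opprK.
  move=> [[c vc] de]; apply/(@gamma_pole_c1 (fun k => - v k)); split=> //.
  by exists (- c) => k; rewrite vc.
rewrite !pole.
case: (diagsgnP v) => [[c [vc ->]]|[vn ->]]; last first.
  rewrite !asboolF ?invr1 ?mul1r ?expr0z //; by move=> [[c vc]]; case: (vn c).
(* The sum of the [sigma k] being 2 makes this shift even, as the positions of the poles require. *)
have sE : s = 2 * c.
  rewrite /s -hsigma mulr_suml; apply: eq_bigr => k _; by rewrite vc.
have -> : `[< (exists c, forall k, v k = c) /\ (exists d : nat, - 2 - s = 2 * d%:Z) >]
    = (c < 0).
  apply/asboolP/idP => [[_ [d]]|c0]; first by rewrite sE; lia.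
  by split; [exists c | exists (absz (- 1 - c)%R); rewrite sE; lia].
have -> : `[< (exists c, forall k, v k = c) /\
     (exists d : nat, 2 * (zeta + s) - s = 2 * d%:Z) >] = (0 <= c).
  rewrite -(vz _ vc).
  apply/asboolP/idP => [[_ [d]]|c0]; first by rewrite sE; lia.
  by split; [exists c | exists (absz (zeta + c)%R); rewrite sE; lia].
by case: (leP 0 c) => _; rewrite ?invr1 ?mul1r ?mulr1 ?exprN1.
Qed.
End ZeroWeights.

(** * Localization at a fixed point *)

Section BoxLines.
Variables (n : nat) (lam : plane_partition n) (sigma : 'I_3 -> int).
Implicit Types z : {ffun 'I_n -> nat}.

Lemma eq_ell (v v' : 'I_3 -> int) (e e' : int) :
  v =1 v' -> e = e' -> ell sigma v e = ell sigma v' e'.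
Proof. by move=> /funext -> ->. Qed.

Lemma ellD v v' e e' :
  ell sigma v e + ell sigma v' e' = ell sigma (fun k => v k + v' k) (e + e').
Proof.
have -> : ell sigma v e + ell sigma v' e'
  = ((e + \sum_(k < 3) sigma k * v k) + (e' + \sum_(k < 3) sigma k * v' k),
     ([ffun k => - v k] + [ffun k => - v' k], e + e')) by [].
congr (_, (_, _)); last by apply/ffunP => k; rewrite !ffunE opprD.
by rewrite addrACA -big_split; congr (_ + _); apply: eq_bigr => k _; rewrite mulrDr.
Qed.

Lemma ell0 : ell sigma (fun=> 0) 0 = 0.
Proof.
have -> : 0 = (0, (0 : {ffun 'I_3 -> int}, 0)) :> PicT by [].
rewrite /ell; congr (_, (_, _)).
by rewrite add0r big1 // => k _; rewrite mulr0.
Qed.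

Lemma ellN v e : - ell sigma v e = ell sigma (fun k => - v k) (- e).
Proof.
apply/eqP; rewrite eq_sym -subr_eq0 opprK ellD -ell0; apply/eqP.
by apply: eq_ell => [k|]; rewrite addNr.
Qed.

Lemma ellMn v (m : nat) : ell sigma v 0 *+ m = ell sigma (fun k => v k *+ m) 0.
Proof.
elim: m => [|m IH]; first by rewrite mulr0n -ell0; exact: eq_ell.
by rewrite mulrS IH ellD; apply: eq_ell => // k; rewrite mulrS.
Qed.

Lemma ell_sum (I : Type) (r : seq I) (v : I -> 'I_3 -> int) :
  \sum_(i <- r) ell sigma (v i) 0 = ell sigma (fun k => \sum_(i <- r) v i k) 0.
Proof.
elim: r => [|i r IH].
  by rewrite big_nil -ell0; apply: eq_ell => // k; rewrite big_nil.
by rewrite big_cons IH ellD; apply: eq_ell => // k; rewrite big_cons.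
Qed.

Lemma Ltw_ell k : Ltw sigma k = ell sigma (fun l => - unitv k l) 0.
Proof.
have -> : Ltw sigma k = (- sigma k + 0, (0 + [ffun l => (l == k)%:R], 0 + 0)) by [].
congr (_, (_, _)); last by apply/ffunP => l; rewrite !ffunE opprK add0r.
rewrite add0r addr0 (bigD1 k) //= big1 ?addr0 /unitv ?eqxx ?mulrN1 // => l lk.
by rewrite (negPf lk) oppr0 mulr0.
Qed.

Lemma Lbox_ell z i : Lbox lam sigma z i = ell sigma (zvec (boxn lam i)) (z i)%:Z.
Proof.
rewrite /Lbox -addrA.
have -> : OP1 (z i)%:Z + triv (qchar *~ (z i)%:Z) = ell sigma (fun=> 0) (z i)%:Z.
  congr (_, _).
    by rewrite addr0 big1 ?addr0 // => k _; rewrite mulr0.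
  rewrite -pmulrn; elim: (z i) => [|m IH].
    by congr (_, _); apply/ffunP => k; rewrite !ffunE.
  rewrite mulrS addrCA IH; congr (_, _).
  by apply/ffunP => k; rewrite !ffunE.
rewrite (eq_bigr (fun k => ell sigma (fun l => (unitv k l) *+ boxn lam i k) 0)); last first.
  by move=> k _; rewrite Ltw_ell ellMn ellN; apply: eq_ell => // l; rewrite mulNrn opprK.
rewrite ell_sum ellD; apply: eq_ell => [k|]; last by rewrite add0r.
rewrite addr0 (bigD1 k) //= big1 ?addr0 /unitv ?eqxx ?natz // => l lk.
by rewrite eq_sym (negPf lk) mul0rn.
Qed.

Lemma LboxB_ell z i j : - Lbox lam sigma z j + Lbox lam sigma z i
  = ell sigma (fun l => zvec (boxn lam i) l - zvec (boxn lam j) l) ((z i)%:Z - (z j)%:Z).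
Proof.
by rewrite !Lbox_ell ellN ellD; apply: eq_ell => [l|]; rewrite addrC.
Qed.

Lemma LboxBLtw_ell z i j k : - Lbox lam sigma z j + Lbox lam sigma z i + Ltw sigma k
  = ell sigma (fun l => zvec (boxn lam i) l - zvec (boxn lam j) l - unitv k l)
      ((z i)%:Z - (z j)%:Z).
Proof.
by rewrite LboxB_ell Ltw_ell ellD; apply: eq_ell => // ; rewrite addr0.
Qed.

Lemma class_calV z :
  class (calV lam sigma z) = \sum_(i < n) lineK (Lbox lam sigma z i).
Proof. by rewrite /class /calV big_map big_enum. Qed.

Lemma sum_EndB (F : PicT -> KTP1) z :
  \sum_(M <- EndB (calV lam sigma z)) F M
  = \sum_(i < n) \sum_(j < n) F (- Lbox lam sigma z j + Lbox lam sigma z i).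
Proof.
rewrite /EndB /tensorB /dualB /calV big_allpairs_dep big_map big_map big_enum /=.
by rewrite exchange_big big_map big_enum.
Qed.

Lemma class_EndB z : class (EndB (calV lam sigma z))
  = \sum_(i < n) \sum_(j < n) lineK (- Lbox lam sigma z j + Lbox lam sigma z i).
Proof. exact: sum_EndB. Qed.

Lemma class_EndL z : class (EndL sigma (calV lam sigma z))
  = \sum_(k < 3) \sum_(i < n) \sum_(j < n)
      lineK (- Lbox lam sigma z j + Lbox lam sigma z i + Ltw sigma k).
Proof.
rewrite /class /EndL big_flatten /= big_map big_enum /=; apply: eq_bigr => k _.
rewrite [X in \sum_(L <- X) _]/tensorB big_allpairs_dep /=.
rewrite (eq_bigr (fun M => lineK (M + Ltw sigma k))); last by move=> M _; rewrite big_seq1.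
by rewrite sum_EndB.
Qed.

Lemma boxes_size_seq : size (boxes lam) = n.
Proof. by rewrite -[RHS](boxes_size lam). Qed.

Lemma big_boxn (V : nmodType) (F : box -> V) :
  \sum_(b <- boxes lam) F b = \sum_(i < n) F (boxn lam i).
Proof.
by rewrite (big_nth [ffun=> 0%N]) boxes_size_seq big_mkord.
Qed.

Lemma diagsgn_boxn :
  \sum_(i < n) diagsgn (zvec (boxn lam i))
  + \sum_(k < 3) \sum_(i < n) \sum_(j < n)
      diagsgn (fun l => zvec (boxn lam i) l - zvec (boxn lam j) l - unitv k l)
  - \sum_(i < n) \sum_(j < n)
      diagsgn (fun l => zvec (boxn lam i) l - zvec (boxn lam j) l) = 0.
Proof.
have dc : down_closed (boxes lam).
  by move=> b c cb bA; apply: boxes_closed bA.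
have := diagsgn_total (fset_uniq (boxes lam)) dc.
rewrite !big_boxn => total; rewrite -[RHS]total; congr (_ + _ - _).
  apply: eq_bigr => k _; rewrite big_boxn; apply: eq_bigr => i _.
  by rewrite big_boxn.
by apply: eq_bigr => i _; rewrite big_boxn.
Qed.

(** If [c >= 0], box [i] dominates box [j]; if [c < 0], the correction [eps <= 1] cannot prevent [j]
    from dominating [i]. Monotonicity then makes the difference of the [z] agree in sign with [c].
    The flag [eps] covers End V and its twists together. *)
Lemma zdiff_sign z i j (eps : 'I_3 -> bool) c : admissible lam z ->
  (forall l, zvec (boxn lam i) l - zvec (boxn lam j) l - (eps l)%:R = c) ->
  (0 <= (z i)%:Z - (z j)%:Z + c) = (0 <= c).
Proof.
move=> adm vc; case: (leP 0 c) => c0.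
  have : (z j <= z i)%N.
    apply: (box_monotone adm) => l; have := vc l; rewrite /zvec -lez_nat.
    by case: (eps l); lia.
  by lia.
have : (z i <= z j)%N.
  apply: (box_monotone adm) => l; have := vc l; rewrite /zvec -lez_nat.
  by case: (eps l); lia.
by lia.
Qed.
End BoxLines.

Section FixedPoint.
Variables (R : realType) (P : eqparam R) (sigma : 'I_3 -> int).
Hypotheses (hP : generic P) (hsigma : \sum_(k < 3) sigma k = 2).
Variables (n : nat) (lam : plane_partition n) (z : {ffun 'I_n -> nat}).
Hypothesis adm : admissible lam z.
Local Notation h := (hbar P).
Local Notation G := (Gamma2h P).
Local Notation e := (euler P).
Local Notation V := (calV lam sigma z).
Local Notation L := (Lbox lam sigma z).
Local Notation u := (ubox P lam sigma).
Local Notation dd i := ((dbox lam sigma z i)%:~R : R[i]).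
Local Notation chi E := (chiP1 (class E)).

Let e10 := generic_e1 hP.
Let h0 := generic_h hP.
Let th0 := two_h_neq0 h0.

Lemma mprod_chi_lineK (c : Tchar -> R[i]) M : (forall x, c x != 0) ->
  mprod c (chiP1 (lineK M)) = mprod c (chi_line M).
Proof.
by move=> c0; rewrite /chiP1 mprod_fglift // mprodU // => N; exact: mprod_neq0.
Qed.

Lemma mprod_chi_sum (c : Tchar -> R[i]) (I : Type) (r : seq I) (D : I -> KTP1) :
  (forall x, c x != 0) ->
  mprod c (chiP1 (\sum_(i <- r) D i)) = \prod_(i <- r) mprod c (chiP1 (D i)).
Proof. by move=> c0; rewrite /chiP1 fglift_sum mprod_sum. Qed.

Lemma prod_expz (a : R[i]) (I : Type) (r : seq I) (F : I -> int) : a != 0 ->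
  \prod_(i <- r) a ^ F i = a ^ (\sum_(i <- r) F i).
Proof.
by move=> a0; rewrite (big_morph (fun k : int => a ^ k) (fun k l => expfzDr k l a0) (expr0z a)).
Qed.

Lemma mprod_V (c : Tchar -> R[i]) : (forall x, c x != 0) ->
  mprod c (chi V) = \prod_(i < n) mprod c (chi_line (L i)).
Proof.
move=> c0; rewrite class_calV mprod_chi_sum //.
by apply: eq_bigr => i _; rewrite mprod_chi_lineK.
Qed.

Lemma mprod_End (c : Tchar -> R[i]) : (forall x, c x != 0) ->
  mprod c (chi (EndB V)) = \prod_(i < n) \prod_(j < n) mprod c (chi_line (- L j + L i)).
Proof.
move=> c0; rewrite class_EndB mprod_chi_sum //; apply: eq_bigr => i _.
by rewrite mprod_chi_sum //; apply: eq_bigr => j _; rewrite mprod_chi_lineK.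
Qed.

Lemma mprod_EndL (c : Tchar -> R[i]) : (forall x, c x != 0) ->
  mprod c (chi (EndL sigma V)) = \prod_(k < 3) \prod_(i < n) \prod_(j < n)
    mprod c (chi_line (- L j + L i + Ltw sigma k)).
Proof.
move=> c0; rewrite class_EndL mprod_chi_sum //; apply: eq_bigr => k _.
rewrite mprod_chi_sum //; apply: eq_bigr => i _.
by rewrite mprod_chi_sum //; apply: eq_bigr => j _; rewrite mprod_chi_lineK.
Qed.

(** Each line bundle contributes [a] to the power [diagsgn], so the quotient is [a] to the total
    computed by [diagsgn_boxn]. *)
Lemma zero_weights_cancel (a : R[i]) : a != 0 ->
  let Z := mprod (fun x => zero_weight a (c1 P x)) in
  Z (chi V) * Z (chi (EndL sigma V)) / Z (chi (EndB V)) = 1.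
Proof.
move=> a0 Z.
have c0 x : zero_weight a (c1 P x) != 0 by exact: zero_weight_neq0.
rewrite /Z mprod_V // mprod_End // mprod_EndL //.
under eq_bigr => i _.
  rewrite Lbox_ell zero_count_ell //; first over.
  (* For V itself both [c] and [z i] are natural numbers, so both comparisons are true. *)
  by move=> c /(_ ord0) <-; rewrite /zvec; lia.
under [X in _ * X / _]eq_bigr => k _.
  under eq_bigr => i _.
    under eq_bigr => j _.
      rewrite LboxBLtw_ell zero_count_ell //; first over.
      by move=> c vc; apply: (zdiff_sign (eps := fun l => l == k) adm vc).
    rewrite prod_expz //; over.
  rewrite prod_expz //; over.
rewrite prod_expz // prod_expz //.
under [X in _ / X]eq_bigr => i _.
  under eq_bigr => j _.
    rewrite LboxB_ell zero_count_ell //; first over.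
    move=> c vc; apply: (zdiff_sign (eps := fun=> false) adm) => l.
    by rewrite subr0; exact: vc.
  rewrite prod_expz //; over.
rewrite prod_expz // -expfzDr // (subr0_eq (diagsgn_boxn lam)).
by rewrite divff // expfz_neq0.
Qed.

(** Identifying the signed root thus reduces to checking that the radicand is the square of the
    prescribed value. *)
Lemma sqrt_sign_sqr (r x : R[i]) : x = r ^+ 2 -> sqrt_sign r x = r.
Proof.
move=> ->; rewrite /sqrt_sign; case: ifPn => [/eqP//|].
have : sqrtC (r ^+ 2) ^+ 2 == r ^+ 2 by rewrite sqrtCK.
by rewrite eqf_sqr => /orP[->//|/eqP -> _]; rewrite opprK.
Qed.

(** The degree is read off from the constant character 2 with values in [rat], since k -> 2^k is
    injective on integers. *)
Lemma deg_fgmap (X Y : choiceType) (f : X -> Y) (D : {freeg X / int}) :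
  freeg.deg (Defs.fgmap f D) = freeg.deg D.
Proof.
have two0 : (2 : rat) != 0 by [].
apply: (@ieexprIz _ (2 : rat)) => //.
by rewrite -!mprod_cst // mprod_fgmap.
Qed.

Lemma euler_dualK D : e (dualK D) = mprod (fun x => efac P (- c1 P x)) D.
Proof.
rewrite /dualK -[LHS]/(mprod (fun x => efac P (c1 P x)) _) mprod_fgmap; last first.
  by move=> x; exact: efac_neq0.
by apply: eq_mprod => x; rewrite /= c1N.
Qed.

(** Duality changes the sign of a nonzero Chern class but leaves the formal symbol [e1] fixed;
    [zero_weight (-1)] records this discrepancy. *)
Lemma efacN x : -1 * efac P (- x) = efac P x * zero_weight (-1) x.
Proof.
rewrite /efac /zero_weight oppr_eq0; case: ifP => _; first by rewrite mulrC.
by rewrite mulrN mulN1r opprK mulr1.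
Qed.

(** Up to its zero weights, the dual of a class has Euler class (-1)^rank times the original. The
    sign (-1)^(vdim/2) absorbs the ranks, and the radicand becomes the expected square times the
    zero-weight sign, which is 1. *)
Lemma sqrt_eulerE :
  sqrt_euler P sigma V = e (chi V) * e (chi (EndL sigma V)) / e (chi (EndB V)).
Proof.
have ef0 x : efac P (c1 P x) != 0 by exact: efac_neq0.
have N0 : -1 != 0 :> R[i] by rewrite oppr_eq0 oner_neq0.
have chiW : chi (calW sigma V) = chi V + chi (EndL sigma V).
  have -> : class (calW sigma V) = class V + class (EndL sigma V).
    by rewrite /class /calW big_cat.
  exact: fgliftD.
have eD D D' : e (D + D') = e D * e D' by exact: mprodD.
have eN D : e (- D) = (e D)^-1 by exact: mprodN.
have eD0 D : e D != 0 by exact: mprod_neq0.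
rewrite /sqrt_euler eN -eD -chiW; apply: sqrt_sign_sqr.
set W := chi (calW sigma V); set E := chi (EndB V).
pose Z := mprod (fun x => zero_weight (-1) (c1 P x)).
have dual D : (-1) ^ freeg.deg D * e (dualK D) = e D * Z D.
  rewrite -(mprod_cst D N0) euler_dualK -!mprodM; apply: eq_mprod => x.
  exact: efacN.
have ZWE : Z W / Z E = 1.
  rewrite /W chiW [Z (_ + _)]mprodD; first exact: zero_weights_cancel.
  by move=> x; exact: zero_weight_neq0.
have ZE0 : Z E != 0 by apply: mprod_neq0 => x; exact: zero_weight_neq0.
(* Dualizing preserves rank, so vdim is twice the difference of the ranks and the integer division
   is exact. *)
have -> : (freeg.deg (Tvir sigma V) %/ 2)%Z = freeg.deg W - freeg.deg E.
  rewrite /Tvir -/W -/E degB !degD !deg_fgmap.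
  have -> : freeg.deg W + freeg.deg W - (freeg.deg E + freeg.deg E)
    = (freeg.deg W - freeg.deg E) * 2 by ring.
  by rewrite mulzK.
rewrite /Tvir -/W -/E !(eD, eN) expfzDr // -invr_expz.
have alg (a b c d x y : R[i]) : x / y * (a * b / (c * d)) = (a * (x * b)) / (c * (y * d)).
  by rewrite !invfM; ring.
rewrite alg !dual.
have alg' (a c x y : R[i]) : a * (a * x) / (c * (c * y)) = (a / c) ^+ 2 * (x / y).
  by rewrite !invfM; ring.
by rewrite alg' ZWE mulr1.
Qed.
End FixedPoint.

(** * Euler classes as quotients of Gamma values *)

Section GammaForm.
Variables (R : realType) (P : eqparam R) (sigma : 'I_3 -> int).
Hypotheses (hP : generic P) (hsigma : \sum_(k < 3) sigma k = 2).
Variables (n : nat) (lam : plane_partition n) (z : {ffun 'I_n -> nat}).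
Hypothesis adm : admissible lam z.
Local Notation h := (hbar P).
Local Notation G := (Gamma2h P).
Local Notation e := (euler P).
Local Notation V := (calV lam sigma z).
Local Notation L := (Lbox lam sigma z).
Local Notation u := (ubox P lam sigma).
Local Notation d := (dbox lam sigma z).
Local Notation dd i := ((dbox lam sigma z i)%:~R : R[i]).
Local Notation s k := ((sigma k)%:~R : R[i]).
Local Notation chi E := (chiP1 (class E)).

Let e10 := generic_e1 hP.
Let h0 := generic_h hP.
Let th0 := two_h_neq0 h0.

(* First Chern class of the fibre at infinity: there [x] trivializes O(1), so
   that O(1) restricts to [q^-1], of class [h]. *)
Definition c1_infty (M : PicT) : R[i] := c1 P M.2 + M.1%:~R * h.

Lemma c1_inftyD : {morph c1_infty : M N / M + N}.
Proof.
move=> M N; rewrite /c1_infty.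
have -> : (M + N).2 = M.2 + N.2 by [].
have -> : (M + N).1 = M.1 + N.1 by [].
by rewrite c1D rmorphD /=; ring.
Qed.

Lemma c1_inftyN M : c1_infty (- M) = - c1_infty M.
Proof. by rewrite -[- M]mulrN1z (morphMz c1_inftyD) mulrN1z. Qed.

(** The twist [q^z] contributes [- z * h] and the fibre of [O(z)] at infinity contributes [+ z * h].
    The result is independent of [z], as it must be when the value at infinity is fixed. *)
Lemma c1_infty_Lbox i : c1_infty (L i) = u i.
Proof.
rewrite Lbox_ell /c1_infty /ubox /hbox /sbox /c1 /c1q /= rmorphD /=.
have -> : \sum_(k < 3) sigma k * zvec (boxn lam i) k = \sum_(k < 3) (boxn lam i k)%:Z * sigma k.
  by apply: eq_bigr => k _; rewrite mulrC.
have -> : \sum_(k < 3) hb P k *~ [ffun k0 => - zvec (boxn lam i) k0] k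
    = - \sum_(k < 3) hb P k *+ boxn lam i k.
  by rewrite -sumrN; apply: eq_bigr => k _; rewrite ffunE mulrNz.
by rewrite -(mulrzr (- h) (z i)%:Z); ring.
Qed.

Lemma c1_infty_Ltw k : c1_infty (Ltw sigma k) = hb P k - s k * h.
Proof.
have -> : c1_infty (Ltw sigma k) = c1 P (0 + tchar k) + (- sigma k + 0)%:~R * h by [].
rewrite add0r addr0 rmorphN mulNr; congr (_ - _).
rewrite /c1 (bigD1 k) //= big1 => [|l lk]; first by rewrite ffunE eqxx mulr0z !addr0.
by rewrite ffunE (negPf lk).
Qed.

(** Passing from infinity to 0 shifts the first Chern class of a line bundle by [- 2 * h] times its
    degree, so the Chern root at 0 is [u i - 2 * d i * h]. *)
Lemma tau_at_xbox (tau : KGLT n) :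
  e (at0 (tauB tau L)) = tau_at P tau (xbox P lam sigma z).
Proof.
have ef0 (x : R[i]) : efac P x != 0 by exact: efac_neq0.
pose a (M : PicT) := c1 P (at0_line M).
have aE M : a M = c1_infty M - 2 * M.1%:~R * h.
  by rewrite /a /at0_line c1D c1Mz c1_qchar /c1_infty -(mulrzr (- h) M.1); ring.
have aD : {morph a : M N / M + N}.
  move=> M N; rewrite !aE c1_inftyD.
  have -> : (M + N).1 = M.1 + N.1 by [].
  by rewrite rmorphD /=; ring.
have a0 : a 0 = 0 by apply: (@addrI _ (a 0)); rewrite -aD !addr0.
rewrite -[LHS]/(mprod (fun x => efac P (c1 P x)) (Defs.fgmap at0_line (tauB tau L))).
rewrite mprod_fgmap; last by move=> x; exact: ef0.
rewrite mprod_fgmap; last by move=> x; exact: ef0.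
transitivity (mprod (fun w : GLTchar n =>
    efac P (\sum_(i < n) xbox P lam sigma z i *~ w.1 i + c1 P w.2)) tau); last by [].
apply: eq_mprod => w /=; congr efac; rewrite -/(a _) aD (big_morph _ aD a0); congr (_ + _); last first.
  by rewrite /a /at0_line /= mulr0z addr0.
apply: eq_bigr => i _; rewrite (morphMz aD) aE c1_infty_Lbox; congr (_ *~ _).
by rewrite -[(L i).1]/(degL (L i)) degL_Lbox /xbox /ubox /c1q; ring.
Qed.

Lemma mprod_line_gamma (m : R[i]) (M : PicT) :
  mprod (fun x => efac P (c1 P x + m) * zero_weight (2 * h) (c1 P x + m)) (chi_line M)
  = (2 * h) ^ (M.1 + 1)
    / (G (c1_infty M - 2 * M.1%:~R * h + m) / G (c1_infty M + 2 * h + m)).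
Proof.
have G0 x : G (x + m) != 0 by exact: Gamma2h_neq0.
have f0 x : efac P (x + m) * zero_weight (2 * h) (x + m) != 0.
  by rewrite mulf_neq0 ?efac_neq0 ?zero_weight_neq0.
rewrite (mprod_chi_line f0 G0 th0) ?invf_div // => x.
by rewrite (Gamma2h_rec h0 e10) addrAC.
Qed.

Let Gam (m y a : R[i]) := G (y - 2 * a * h + m) / G (y + 2 * h + m).

Lemma Lbox_line_gamma m i :
  mprod (fun x => efac P (c1 P x + m) * zero_weight (2 * h) (c1 P x + m)) (chi_line (L i))
  = (2 * h) ^ (d i + 1) / Gam m (u i) (dd i).
Proof.
by rewrite mprod_line_gamma c1_infty_Lbox -[(L i).1]/(degL (L i)) degL_Lbox.
Qed.

Let zw m x := zero_weight (2 * h) (c1 P x + m).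
Let ef m x := efac P (c1 P x + m).

Lemma efzw0 m x : ef m x * zw m x != 0.
Proof. by rewrite mulf_neq0 ?efac_neq0 ?zero_weight_neq0. Qed.

Lemma sum_diff_cst (D : 'I_n -> int) (c : int) :
  \sum_(i < n) \sum_(j < n) (D i - D j + c) = c * (n * n)%N%:Z.
Proof.
rewrite (eq_bigr (fun i => D i *+ n - \sum_(j < n) D j + c *+ n)) => [|i _].
  rewrite !big_split /= sumrN !sumr_const card_ord sumrMnl subrr add0r.
  by rewrite -mulrnA -mulr_natr natz.
by rewrite !big_split /= sumrN !sumr_const card_ord.
Qed.

Lemma euler_V_gamma m :
  mprod (ef m) (chi V) * mprod (zw m) (chi V)
  = (2 * h) ^ (\sum_(i < n) d i + n%:Z) / \prod_(i < n) Gam m (u i) (dd i).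
Proof.
rewrite -mprodM mprod_V; last exact: efzw0.
under eq_bigr => i _ do rewrite Lbox_line_gamma.
rewrite big_split /= prodfV prod_expz //; congr (_ ^ _ / _).
by rewrite big_split /= sumr_const card_ord natz.
Qed.

Lemma euler_End_gamma :
  mprod (ef 0) (chi (EndB V)) * mprod (zw 0) (chi (EndB V))
  = (2 * h) ^ (n * n)%N%:Z
    / \prod_(i < n) \prod_(j < n) Gam 0 (u i - u j) (dd i - dd j).
Proof.
rewrite -mprodM mprod_End; last exact: efzw0.
have line i j : mprod (fun x => ef 0 x * zw 0 x) (chi_line (- L j + L i))
    = (2 * h) ^ (d i - d j + 1) / Gam 0 (u i - u j) (dd i - dd j).
  rewrite mprod_line_gamma c1_inftyD c1_inftyN !c1_infty_Lbox.
  have -> : (- L j + L i).1 = d i - d j.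
    by rewrite -!degL_Lbox addrC.
  by rewrite [- u j + u i]addrC rmorphB.
under eq_bigr => i _ do under eq_bigr => j _ do rewrite line.
under eq_bigr => i _ do rewrite big_split /= prodfV prod_expz //.
rewrite big_split /= prodfV prod_expz //; congr (_ ^ _ / _).
by rewrite sum_diff_cst mul1r.
Qed.

Lemma euler_EndL_gamma :
  mprod (ef 0) (chi (EndL sigma V)) * mprod (zw 0) (chi (EndL sigma V))
  = (2 * h) ^ (n * n)%N%:Z / \prod_(k < 3) \prod_(i < n) \prod_(j < n)
      Gam 0 (u i - u j + hb P k - s k * h) (dd i - dd j - s k).
Proof.
rewrite -mprodM mprod_EndL; last exact: efzw0.
have line k i j : mprod (fun x => ef 0 x * zw 0 x) (chi_line (- L j + L i + Ltw sigma k))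
    = (2 * h) ^ (d i - d j + (1 - sigma k))
      / Gam 0 (u i - u j + hb P k - s k * h) (dd i - dd j - s k).
  rewrite mprod_line_gamma 2!c1_inftyD c1_inftyN !c1_infty_Lbox c1_infty_Ltw.
  have -> : (- L j + L i + Ltw sigma k).1 = d i - d j - sigma k.
    by rewrite -!degL_Lbox /degL /=; ring.
  rewrite [- u j + u i]addrC addrA !rmorphB /=; congr ((2 * h) ^ _ / _); ring.
under eq_bigr => k _ do under eq_bigr => i _ do under eq_bigr => j _ do rewrite line.
under eq_bigr => k _ do
  under eq_bigr => i _ do rewrite big_split /= prodfV prod_expz //.
under eq_bigr => k _ do rewrite big_split /= prodfV prod_expz //.
rewrite big_split /= prodfV prod_expz //; congr (_ ^ _ / _).
(* The differences [d i - d j] cancel by antisymmetry. What remains is the sum of the [1 - sigma k],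
   equal to 3 - 2 = 1, times [n * n]: the same power as for End V. *)
under eq_bigr => k _ do rewrite sum_diff_cst.
rewrite -mulr_suml big_split /= sumrN hsigma sumr_const card_ord.
by rewrite mulrBl; ring.
Qed.

Lemma quotient_cancel (a kV kE eV eE eW zV zE zW gV gE gW : R[i]) :
  [/\ kV != 0, kE != 0, gV != 0, gE != 0 & gW != 0] ->
  [/\ zV != 0, zE != 0, zW != 0, eV != 0 & eW != 0] ->
  zV * zW / zE = 1 ->
  eV * zV = kV / gV -> eE * zE = kE / gE -> eW * zW = kE / gW ->
  a * eE / (eV * eW) = a * kV^-1 * gV * (gW / gE).
Proof.
move=> [kV0 kE0 gV0 gE0 gW0] [zV0 zE0 zW0 eV0 eW0] z1 hV hE hW.
have -> : eE = kE / gE / zE by rewrite -hE mulfK.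
have -> : eV = kV / gV / zV by rewrite -hV mulfK.
have -> : eW = kE / gW / zW by rewrite -hW mulfK.
rewrite -[RHS]mulr1 -z1; field.
by rewrite kV0 kE0 gV0 gE0 gW0 zV0 zE0 zW0.
Qed.

Let gammaV m := \prod_(i < n) (G (u i - 2 * dd i * h + m) / G (u i + 2 * h + m)).
Let gammaW := \prod_(k < 3) \prod_(i < n) \prod_(j < n)
  (G (u i - u j - 2 * (dd i - dd j) * h + hb P k + s k * h)
   / G (u i - u j + hb P k - s k * h + 2 * h)).
Let gammaE := \prod_(i < n) \prod_(j < n)
  (G (u i - u j - 2 * (dd i - dd j) * h) / G (u i - u j + 2 * h)).

Lemma prodr_neq0 (I : eqType) (r : seq I) (F : I -> R[i]) :
  (forall i, F i != 0) -> \prod_(i <- r) F i != 0.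
Proof. by move=> F0; rewrite prodf_seq_neq0; apply/allP => i _; exact: F0. Qed.

Lemma euler_quotient_gamma (a : R[i]) :
  a * e (chi (EndB V)) / (e (chi V) * e (chi (EndL sigma V)))
  = a * ((2 * h) ^ (\sum_(i < n) d i + n%:Z))^-1 * gammaV 0 * (gammaW / gammaE).
Proof.
have ef0E D : mprod (ef 0) D = e D by apply: eq_mprod => x; rewrite /ef addr0.
have zw0E D : mprod (zw 0) D = mprod (fun x => zero_weight (2 * h) (c1 P x)) D.
  by apply: eq_mprod => x; rewrite /zw addr0.
have zn0 D : mprod (zw 0) D != 0.
  by apply: mprod_neq0 => x; exact: zero_weight_neq0.
have en0 D : e D != 0 by apply: mprod_neq0 => x; exact: efac_neq0.
have Ggam (x y : R[i]) : G x / G y != 0.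
  by rewrite mulf_neq0 ?invr_eq0 ?Gamma2h_neq0.
have WE : \prod_(k < 3) \prod_(i < n) \prod_(j < n)
    Gam 0 (u i - u j + hb P k - s k * h) (dd i - dd j - s k) = gammaW.
  apply: eq_bigr => k _; apply: eq_bigr => i _; apply: eq_bigr => j _.
  by rewrite /Gam !addr0; congr (G _ / _); ring.
have EE : \prod_(i < n) \prod_(j < n) Gam 0 (u i - u j) (dd i - dd j) = gammaE.
  by apply: eq_bigr => i _; apply: eq_bigr => j _; rewrite /Gam !addr0.
have := euler_V_gamma 0; have := euler_End_gamma; have := euler_EndL_gamma.
rewrite !ef0E WE EE => hW hE hV.
apply: (quotient_cancel _ _ _ _ hV hE hW).
- split; rewrite ?expfz_neq0 //; do ?[apply: prodr_neq0 => ?]; exact: Ggam.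
- by split.
- by rewrite !zw0E; apply: zero_weights_cancel.
Qed.

Lemma euler_m_gamma (m : R[i]) : generic_mass P m ->
  euler_m P m (twist_em (chi V))
  = (2 * h) ^ (\sum_(i < n) d i + n%:Z) / gammaV m.
Proof.
move=> hm; rewrite -euler_V_gamma.
rewrite -[LHS]/(mprod (fun w : Tchar * int => efac P (c1 P w.1 + m *~ w.2)) _).
rewrite mprod_fgmap; last by move=> w; exact: efac_neq0.
rewrite -mprodM; apply: eq_mprod => x; rewrite /ef /zw /= mulr1z /zero_weight.
(* A generic mass keeps every weight of the twisted class away from zero, so no zero-weight
   correction arises. *)
rewrite ifF ?mulr1 //; apply/negP => /eqP xm.
by have := hm 1 x; rewrite mulr1z addrC xm => /(_ erefl).
Qed.

(** The mass-twisted Euler class brings the same power of [2 * h] as [chi V] in the denominator,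
    which is why none survives here. *)
Lemma euler_m_quotient_gamma (m a : R[i]) : generic_mass P m ->
  euler_m P m (twist_em (chi V)) * a * e (chi (EndB V))
    / (e (chi V) * e (chi (EndL sigma V)))
  = a * (gammaV 0 / gammaV m) * (gammaW / gammaE).
Proof.
move=> hm; rewrite euler_quotient_gamma euler_m_gamma //.
set k := (2 * h) ^ _; have k0 : k != 0 by rewrite expfz_neq0.
have -> : k / gammaV m * a * k^-1 = a * (gammaV m)^-1 * (k / k) by ring.
by rewrite divff // mulr1; ring.
Qed.
End GammaForm.

(** * Passage from single fixed points to the coefficients of the series *)

Lemma eq_zseries (R : realType) (n : nat) (lam : plane_partition n) (sigma : 'I_3 -> int)
    (F F' : {ffun 'I_n -> nat} -> R[i]) :
  (forall z, admissible lam z -> F z = F' z) ->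
  zseries lam sigma F =1 zseries lam sigma F'.
Proof.
by move=> FF d; apply: eq_fsbigr => z; rewrite inE /= => -[/FF].
Qed.

Lemma sum_QMfixed (R : realType) (n : nat) (lam : plane_partition n) (sigma : 'I_3 -> int)
    (F : {ffun 'I_n -> nat} -> R[i]) (d : int) :
  \sum_(z \in QMfixed lam sigma d) F z = zseries lam sigma F d.
Proof.
suff -> : QMfixed lam sigma d =
  [set z | admissible lam z /\ \sum_(i < n) dbox lam sigma z i = d]%classic by [].
by apply/seteqP; split=> z; rewrite /QMfixed /= degB_calV.
Qed.

Theorem proposition7p10 (R : realType) (P : eqparam R) (n : nat)
    (lam : plane_partition n) (sigma : 'I_3 -> int) (tau : KGLT n)
    (hP : generic P) (hsigma : \sum_(k < 3) sigma k = 2) :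
  let h := hbar P in
  let G := Gamma2h P in
  let u := ubox P lam sigma in
  let V := calV lam sigma in
  let L := Lbox lam sigma in
  let d := dbox lam sigma in
  let dd z i : R[i] := (d z i)%:~R in
  let s k : R[i] := (sigma k)%:~R in
  let e := euler P in
  let chi E := chiP1 (class E) in
  let series := zseries lam sigma in
  let euler1 z :=
    e (at0 (tauB tau (L z))) * e (chi (EndB (V z)))
    / (e (chi (V z)) * e (chi (EndL sigma (V z)))) in
  let euler2 z :=
    e (at0 (tauB tau (L z)))
    * e (chiP1 (\sum_(i < n) \sum_(j < n) lineK (- L z j + L z i)))
    / (e (chiP1 (\sum_(i < n) lineK (L z i)))
       * e (chiP1 (\sum_(k < 3) \sum_(i < n) \sum_(j < n)
                     lineK (- L z j + L z i + Ltw sigma k)))) in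
  let gammaV z :=
    \prod_(i < n) (G (u i - 2 * dd z i * h) / G (u i + 2 * h)) in
  let gammaVm m z :=
    \prod_(i < n) (G (u i - 2 * dd z i * h + m) / G (u i + 2 * h + m)) in
  let gammaEnd z :=
    (\prod_(k < 3) \prod_(i < n) \prod_(j < n)
       (G (u i - u j - 2 * (dd z i - dd z j) * h + hb P k + s k * h)
        / G (u i - u j + hb P k - s k * h + 2 * h)))
    / (\prod_(i < n) \prod_(j < n)
         (G (u i - u j - 2 * (dd z i - dd z j) * h)
          / G (u i - u j + 2 * h))) in
  [/\ vertex P lam sigma tau =1 series euler1,
      series euler1 =1 series euler2,
      series euler2 =1
        series (fun z =>
          (2 * h) ^ (- \sum_(i < n) d z i) * (2 * h) ^- n
          * tau_at P tau (xbox P lam sigma z) * gammaV z * gammaEnd z)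
    & forall m : R[i], generic_mass P m ->
      let euler1m z :=
        euler_m P m (twist_em (chi (V z)))
        * e (at0 (tauB tau (L z))) * e (chi (EndB (V z)))
        / (e (chi (V z)) * e (chi (EndL sigma (V z)))) in
      vertex_m P m lam sigma tau =1 series euler1m /\
      series euler1m =1
        series (fun z =>
          tau_at P tau (xbox P lam sigma z)
          * (gammaV z / gammaVm m z) * gammaEnd z)].

Proof.
move=> h G u V L d dd s e chi series euler1 euler2 gammaV gammaVm gammaEnd.
have h0 : 2 * h != 0 by exact/two_h_neq0/generic_h.
have gammaV0 z : \prod_(i < n) (G (u i - 2 * dd z i * h + 0) / G (u i + 2 * h + 0)) = gammaV z.
  by apply: eq_bigr => i _; rewrite !addr0.
split.
- move=> k; rewrite /vertex sum_QMfixed; apply: eq_zseries => z adm.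
  by rewrite (sqrt_eulerE hP hsigma adm) invf_div mulrA.
- by apply: eq_zseries => z adm; rewrite /euler1 /euler2 /chi class_EndB class_calV class_EndL.
- apply: eq_zseries => z adm.
  have -> : euler2 z = euler1 z by rewrite /euler1 /euler2 /chi class_EndB class_calV class_EndL.
  rewrite /euler1 (euler_quotient_gamma hP hsigma adm) gammaV0 /e /L (tau_at_xbox sigma hP).
  rewrite expfzDr // invfM -invr_expz -!exprnP; congr (_ * _ * _); ring.
- move=> m hm euler1m; split.
    move=> k; rewrite /vertex_m sum_QMfixed; apply: eq_zseries => z adm.
    by rewrite (sqrt_eulerE hP hsigma adm) invf_div !mulrA.
  apply: eq_zseries => z adm.
  by rewrite /euler1m (euler_m_quotient_gamma hP hsigma adm) // gammaV0 /e /L (tau_at_xbox sigma hP).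
Qed.
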